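(* Let $G=(V,E)$ be a planar graph with a fixed planar embedding and edge length $l:E\to\mathbb{R}^{+}$, and let $T$ be the set of geodesic pairs of $G$. Then there exists an embedding $g:V\to L_1$ such that $\|g(u)-g(v)\|\le d_G(u,v)$ for all $(u,v)\in E$ and $\|g(u)-g(v)\|\ge d_G(u,v)/21$ for all $(u,v)\in T$.
   Context: $d_G$ is the shortest-path metric of $G$ with respect to $l$. A pair of vertices $(u,v)$ is a geodesic pair if there is a face $f$ of $G$ whose boundary cycle contains both $u$ and $v$ and some shortest $u$–$v$ path in $G$ uses only edges of that boundary cycle. An embedding into $L_1$ is a map into $\mathbb{R}^k$ for some $k$, with $\|\cdot\|$ the $\ell_1$ norm. *)

(* Defs.v *)
From HB Require Import structures.
From mathcomp Require Import all_boot all_order all_algebra.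
From mathcomp Require Import boolp classical_sets reals.

Set Implicit Arguments.
Unset Strict Implicit.
Unset Printing Implicit Defensive.

Import Order.TTheory GRing.Theory Num.Theory.

Local Open Scope ring_scope.

Record sgraph := SGraph {
  vertex :> finType;
  adj : rel vertex;
  adj_sym : symmetric adj;
  adj_irrefl : irreflexive adj
}.

(* A dart is an edge with a direction: (u, v) leaves u and enters v. *)
Definition dart (G : sgraph) : finType := {d : G * G | adj d.1 d.2}.

Section Darts.
Variable G : sgraph.

Definition dart_src (d : dart G) : G := (val d).1.
Definition dart_tgt (d : dart G) : G := (val d).2.

Lemma dart_rev_subproof (d : dart G) : adj (dart_tgt d) (dart_src d).
Proof. by rewrite adj_sym (valP d). Qed.

Definition dart_rev (d : dart G) : dart G :=
  exist _ (dart_tgt d, dart_src d) (dart_rev_subproof d).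

Definition next_on_face (rot : dart G -> dart G) (d : dart G) : dart G :=
  rot (dart_rev d).

(* Euler's formula V - E + F = 2C, with V, E, F the numbers of orbits of rot,
   dart_rev and next_on_face, #|dart G| = 2E, and C the number of components.
   Isolated vertices carry no dart and are counted nowhere. For a disconnected
   graph each component is drawn on its own sphere, so the summed genus is 0
   iff every component is planar. *)
Definition euler_planar (rot : dart G -> dart G) : Prop :=
  (fcard rot predT + fcard dart_rev predT + fcard (next_on_face rot) predT =
   #|dart G| + 2 * n_comp (relU (frel rot) (frel dart_rev)) predT)%N.

End Darts.

(* A planar embedding, up to homeomorphism of the sphere, is a rotation system
   of genus 0: rot d is the dart following d in the cyclic order of the darts
   around the vertex that d leaves. *)
Record planar_embedding (G : sgraph) := PlanarEmbedding {
  rot : dart G -> dart G;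
  rot_inj : injective rot;
  rot_orbit : forall d d' : dart G,
    fconnect rot d d' = (dart_src d == dart_src d');
  rot_planar : euler_planar rot
}.

Section Faces.
Variables (G : sgraph) (M : planar_embedding G).

(* The boundary of the face lying beside the dart f, as a closed walk. Every
   face of a nonempty map arises this way, from each dart of its boundary. *)
Definition face_boundary (f : dart G) : seq (dart G) :=
  orbit (next_on_face (rot M)) f.

Definition vertex_on_face (f : dart G) (u : G) : bool :=
  u \in [seq dart_src d | d <- face_boundary f].

Definition edge_on_face (f : dart G) (e : G * G) : bool :=
  let b := [seq val d | d <- face_boundary f] in
  (e \in b) || ((e.2, e.1) \in b).

End Faces.

Section Metric.
Variables (R : realType) (G : sgraph) (l : G -> G -> R).

(* The walk u :: p, given as in path.v by its first vertex and the rest. *)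
Definition walk (u v : G) (p : seq G) : bool :=
  path (@adj G) u p && (last u p == v).

Definition walk_edges (u : G) (p : seq G) : seq (G * G) := zip (u :: p) p.

Definition walk_length (u : G) (p : seq G) : R :=
  \sum_(e <- walk_edges u p) l e.1 e.2.

(* Equal to 0, by the convention for inf, when v is not reachable from u. *)
Definition graph_dist (u v : G) : R :=
  inf [set x : R | exists2 p : seq G, walk u v p & x = walk_length u p]%classic.

Definition shortest_path (u v : G) (p : seq G) : Prop :=
  walk u v p /\ walk_length u p = graph_dist u v.

Definition geodesic_pair (M : planar_embedding G) (u v : G) : Prop :=
  exists f : dart G,
    [/\ vertex_on_face M f u, vertex_on_face M f v &
        exists2 p : seq G, shortest_path u v p &
                           all (edge_on_face M f) (walk_edges u p)].

End Metric.

Definition l1_norm (R : realType) (k : nat) (x : 'rV[R]_k) : R :=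
  \sum_(i < k) `|x ord0 i|.

(* Main.v *)
From mathcomp Require Import all_boot all_order all_algebra fingroup perm.
From mathcomp Require Import boolp reals ring lra zify.
Require Import Defs.

Set Implicit Arguments.
Unset Strict Implicit.
Unset Printing Implicit Defensive.

Import Order.TTheory GRing.Theory Num.Theory.

Local Open Scope ring_scope.

(** The embedding is a nonnegative combination of cut metrics.

    Seymour's sums of circuits theorem, applied to the dual graph, shows that in
    a planar graph a combination of cuts realises the distance between the ends
    of every edge at once; splitting the cuts into bonds keeps the load of the
    edges and only increases the separation of other pairs. That the even sets
    of the dual are cuts is a rank computation over F_2 from Euler's formula.

    Rearrange the face boundary walks into simple closed walks, each inside one
    face. Drawing chords inside such a walk keeps the graph planar, so there is
    a packing of bonds of G which does not expand the edges of G and is exact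
    on all the chords. For one closed walk, six systems of chords suffice to
    retain at least half of the length of every geodesic arc in total: the
    greedily chosen maximal geodesic arcs, the best balanced arcs around their
    common end points (every second one in one system, the others in another),
    and three single arcs for the geodesics through the base point. Averaging
    the six packings gives the constant 12. Finally a bond crosses a face within
    one of the simple closed walks only, so the pieces of a geodesic of the face
    that lie on different closed walks add up. *)

(** * Conic combinations *)

Section Dot.
Variables (R : comPzRingType) (E : finType).
Implicit Types (w x z : E -> R).

Definition dot w x : R := \sum_e w e * x e.

Lemma dotC w x : dot w x = dot x w.
Proof. by apply: eq_bigr => e _; rewrite mulrC. Qed.

Lemma dotBZr w x k z : dot w (fun e => x e - k * z e) = dot w x - k * dot w z.
Proof. by rewrite /dot mulr_sumr -sumrB; apply: eq_bigr => e _; ring. Qed.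

End Dot.

Section Farkas.
Variables (R : realFieldType) (E : finType).
Implicit Types (a d u w x : E -> R).

Lemma dot_le0_eq0 d : dot d d <= 0 -> forall e, d e = 0.
Proof.
move=> dd_le0 e; have sq_ge0 f : true -> 0 <= d f * d f by rewrite -expr2 sqr_ge0.
have dd_eq0 : dot d d = 0 by apply/le_anti; rewrite dd_le0 sumr_ge0.
by apply/eqP; rewrite -[_ == 0]orbb -mulf_eq0 (psumr_eq0P sq_ge0 dd_eq0).
Qed.

(* Along [a], onto the hyperplane orthogonal to [u]. *)
Definition oblique_proj u a x (e : E) : R := x e - dot u x / dot u a * a e.

Lemma dot_oblique_proj u a w x :
  dot w (oblique_proj u a x) = dot (oblique_proj a u w) x.
Proof.
rewrite (dotC _ x) !dotBZr (dotC x w) (dotC x u) (dotC a w) (dotC a u).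
ring.
Qed.

Lemma oblique_proj_orthogonal u a w : dot u a != 0 -> dot (oblique_proj a u w) a = 0.
Proof. by move=> ua; rewrite -dot_oblique_proj dotBZr divff // mul1r subrr. Qed.

Definition bidual_cone (I : finType) (a : I -> E -> R) d :=
  forall w, (forall i, 0 <= dot w (a i)) -> 0 <= dot w d.

Definition conic_comb (I : finType) (a : I -> E -> R) d :=
  exists2 y : I -> R, forall i, 0 <= y i & forall e, d e = \sum_i y i * a i e.

Lemma conic_comb_recl n (a : 'I_n.+1 -> E -> R) d (y : 'I_n -> R) k :
  0 <= k -> (forall i, 0 <= y i) ->
  (forall e, d e = k * a ord0 e + \sum_i y i * a (lift ord0 i) e) -> conic_comb a d.
Proof.
move=> k0 y0 dE; exists (fun i => oapp y k (unlift ord0 i)) => [i|e].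
  by case: unlift => [j|] /=.
rewrite dE big_ord_recl unlift_none; congr (_ + _).
by apply: eq_bigr => i _; rewrite liftK.
Qed.

Lemma farkas_ord n (a : 'I_n -> E -> R) d : bidual_cone a d -> conic_comb a d.
Proof.
elim: n a d => [|n IH] a d a_d.
  exists (fun=> 0) => // e; rewrite big_ord0; apply: dot_le0_eq0.
  have := a_d (fun e => 0 - 1 * d e); rewrite dotC dotBZr mul1r.
  have -> : dot d (fun=> 0) = 0 by rewrite /dot big1 // => f _; rewrite mulr0.
  by rewrite sub0r oppr_ge0; apply=> -[].
set a0 := a ord0; pose a' i := a (lift ord0 i).
have [a'_d|/existsNP[u /not_implyP[a'u /negP]]] := pselect (bidual_cone a' d).
  have [y y0 dE] := IH a' d a'_d.
  by apply: (conic_comb_recl (lexx 0) y0) => e; rewrite mul0r add0r dE.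
rewrite -ltNge => ud; have ua0 : dot u a0 < 0.
  rewrite ltNge; apply: contraL ud => ua0; rewrite -leNgt.
  by apply: a_d => i; case: (unliftP ord0 i) => [j|] ->; [exact: a'u|].
have [w w_ge0|y y0 yE] := IH (fun i => oblique_proj u a0 (a' i)) (oblique_proj u a0 d).
  rewrite dot_oblique_proj; apply: a_d => i.
  case: (unliftP ord0 i) => [j|] ->; first by rewrite -dot_oblique_proj; exact: w_ge0.
  by rewrite oblique_proj_orthogonal // lt_eqF.
pose k := (dot u d - \sum_i y i * dot u (a' i)) / dot u a0.
apply: (conic_comb_recl (k := k) _ y0) => [|e].
  rewrite nmulr_lge0 ?invr_lt0 // subr_le0 (le_trans (ltW ud)) //.
  by apply: sumr_ge0 => i _; rewrite mulr_ge0.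
have -> : \sum_i y i * a' i e = oblique_proj u a0 d e +
    (\sum_i y i * dot u (a' i)) / dot u a0 * a0 e.
  rewrite yE !mulr_suml -big_split; apply: eq_bigr => i _ /=.
  by rewrite mulrBr !mulrA subrK.
by rewrite -/a0 /k /oblique_proj; ring.
Qed.

Lemma farkas (I : finType) (a : I -> E -> R) d : bidual_cone a d -> conic_comb a d.
Proof.
move=> a_d; have [w w_ge0|y y0 dE] := @farkas_ord #|I| (fun i => a (enum_val i)) d.
  by apply: a_d => i; rewrite -[i]enum_rankK.
exists (y \o enum_rank) => [i|e]; first exact: y0.
rewrite dE (reindex _ (onW_bij _ (@enum_rank_bij I))).
by apply: eq_bigr => i _; rewrite enum_rankK.
Qed.

End Farkas.

Lemma ratio_test (R : realFieldType) (I : finType) (F G : I -> R) :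
  (forall i, 0 <= F i) -> (forall i, F i = 0 -> G i = 0) -> (exists i, 0 < G i) ->
  exists2 k, 0 <= k & (forall i, 0 <= F i - k * G i) /\
    (#|support (fun i => F i - k * G i)%R| < #|support F|)%N.
Proof.
move=> F0 FG [i Gi].
case: (arg_minP (fun i => F i / G i) (i0 := i) (P := fun i => 0 < G i) Gi) => j Gj jmin.
exists (F j / G j); first by rewrite divr_ge0 // ltW.
split=> [h|].
  have [Gh|Gh] := ltP 0 (G h); first by rewrite subr_ge0 -ler_pdivlMr // jmin.
  by rewrite subr_ge0 (le_trans _ (F0 h)) // mulr_ge0_le0 // divr_ge0 // ltW.
apply: proper_card; apply/properP; split.
  apply/subsetP => h; rewrite !inE; apply: contraNneq => Fh.
  by rewrite Fh (FG h) // mulr0 subr0.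
exists j; rewrite !inE; first by apply: contraTneq Gj => /FG ->; rewrite ltxx.
by rewrite divfK ?subrr ?eqxx // gt_eqF.
Qed.

(** * Symmetric differences and minimal sets *)

Section SymDiff.
Variable E : finType.
Implicit Types A B C : {set E}.

Definition symdiff A B : {set E} := [set e | (e \in A) (+) (e \in B)].

Lemma in_symdiff A B e : (e \in symdiff A B) = (e \in A) (+) (e \in B).
Proof. by rewrite inE. Qed.

Lemma symdiff_disjoint A B : [disjoint A & B] -> symdiff A B = A :|: B.
Proof.
move=> AB; apply/setP => e; rewrite !inE.
by have := @disjointFr _ _ _ e AB; case: (e \in A) => // ->.
Qed.

Lemma symdiff_subset A B : B \subset A -> symdiff A B = A :\: B.
Proof.
move=> BA; apply/setP => e; rewrite !inE.
by have := subsetP BA e; case: (e \in B) => [->//|]; rewrite addbF.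
Qed.

Lemma big_symdiff A B (F : E -> bool) :
  \big[addb/false]_(e in symdiff A B) F e =
  \big[addb/false]_(e in A) F e (+) \big[addb/false]_(e in B) F e.
Proof.
rewrite big_mkcond [X in X (+) _]big_mkcond [X in _ (+) X]big_mkcond -big_split.
by apply: eq_bigr => e _; rewrite inE; do 2 case: (e \in _); case: (F e).
Qed.

Definition minimal_nonempty (F : pred {set E}) : pred {set E} :=
  minset (fun C => F C && (C != set0)).

Lemma minimal_nonempty_eq (F F' : pred {set E}) :
  F =1 F' -> minimal_nonempty F =1 minimal_nonempty F'.
Proof. by move=> FF' C; apply: minset_eq => D /=; rewrite FF'. Qed.

Lemma minimal_nonemptyP {F : pred {set E}} {C : {set E}} : reflect
  [/\ F C, C != set0 & forall C', F C' -> C' \subset C -> C' != set0 -> C' = C]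
  (minimal_nonempty F C).
Proof.
apply: (iffP minsetP) => [[/andP[FC C0] C_min]|[FC C0 C_min]].
  by split=> // C' FC' sC' C'0; apply: C_min => //; rewrite FC'.
by split=> [|C' /andP[FC' C'0] sC']; [rewrite FC|exact: C_min].
Qed.

Lemma symdiff_closed_ind (F : pred {set E}) (P : {set E} -> Prop) :
    (forall A B, F A -> F B -> F (symdiff A B)) -> P set0 ->
    (forall A B, minimal_nonempty F A -> F B -> [disjoint A & B] -> P B ->
      P (A :|: B)) ->
  forall C, F C -> P C.
Proof.
move=> F_symdiff P0 PU C; have [n] := ubnP #|C|; elim: n C => // n IH C leC FC.
have [->//|C0] := eqVneq C set0.
have [|A A_min sA] := @minset_exists _ (fun C => F C && (C != set0)) C.
  by rewrite FC.
have [FA A0 _] := minimal_nonemptyP A_min.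
have FD : F (C :\: A) by rewrite -symdiff_subset //; exact: F_symdiff.
rewrite -(setID C A) (setIidPr sA); apply: PU => //.
  by rewrite -setI_eq0 setIDA setIC -setIDA setDv setI0.
apply: IH => //; rewrite cardsD (setIidPr sA).
by have := subset_leq_card sA; rewrite -card_gt0 in A0; lia.
Qed.

End SymDiff.

Lemma big_addb_eq (T : finType) (P : pred T) (x : T) :
  \big[addb/false]_(y | P y) (x == y) = P x.
Proof.
rewrite big_mkcond (bigD1 x) //= eqxx big1 => [|y /negPf yx]; first by case: (P x).
by rewrite eq_sym yx if_same.
Qed.

(** * Joins and even sets in multigraphs *)

Section Joins.
Variables (V E : finType) (s t : E -> V).
Implicit Types (J C K A : {set E}) (u v x y z : V) (a e f h : E).

Definition odd_end e v := (s e == v) (+) (t e == v).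
Definition star J v := [set e in J | odd_end e v].
Definition odd_degree J v := \big[addb/false]_(e in J) odd_end e v.
Definition even_set J := [forall v, ~~ odd_degree J v].
Definition is_join x y J := [forall v, odd_degree J v == (v == x) (+) (v == y)].

Lemma even_setP J : reflect (forall v, odd_degree J v = false) (even_set J).
Proof. by apply: (iffP forallP) => J_even v; [apply/negbTE|rewrite J_even]. Qed.

Lemma is_joinP x y J :
  reflect (forall v, odd_degree J v = (v == x) (+) (v == y)) (is_join x y J).
Proof. exact: 'forall_eqP. Qed.

Lemma is_joinxx x J : is_join x x J = even_set J.
Proof. by apply/is_joinP/even_setP => J_deg v; rewrite J_deg addbb. Qed.

Lemma is_join_sym x y J : is_join x y J = is_join y x J.
Proof. by apply/is_joinP/is_joinP => J_deg v; rewrite J_deg addbC. Qed.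

Lemma odd_end_nloop e v : odd_end e v -> s e != t e.
Proof. by rewrite /odd_end; apply: contraTneq => ->; rewrite addbb. Qed.

Lemma odd_degree0 v : odd_degree set0 v = false.
Proof. exact: big_set0. Qed.

Lemma odd_degree1 e v : odd_degree [set e] v = odd_end e v.
Proof. exact: big_set1. Qed.

Lemma odd_degree_symdiff J K v :
  odd_degree (symdiff J K) v = odd_degree J v (+) odd_degree K v.
Proof. exact: big_symdiff. Qed.

Lemma odd_degree_star J v : odd_degree J v -> exists e, e \in star J v.
Proof.
move=> Jv; apply/set0Pn; apply: contraTneq Jv => /setP Jv0.
rewrite /odd_degree big1 // => e eJ; have := Jv0 e.
by rewrite !inE eJ.
Qed.

Lemma eq_odd_degree J K v : star J v = star K v -> odd_degree J v = odd_degree K v.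
Proof.
move=> /setP JK; rewrite /odd_degree big_mkcond [RHS]big_mkcond.
by apply: eq_bigr => e _; have := JK e; rewrite !inE; do 2 case: (e \in _); case: odd_end.
Qed.

Lemma starD J K v : star (J :\: K) v = star J v :\: star K v.
Proof. by apply/setP => e; rewrite !inE; do 2 case: (e \in _); case: odd_end. Qed.

Lemma even_set0 : even_set set0.
Proof. by apply/even_setP => v; exact: odd_degree0. Qed.

Lemma is_join_symdiff x y z J K :
  is_join x y J -> is_join y z K -> is_join x z (symdiff J K).
Proof.
move=> /is_joinP J_deg /is_joinP K_deg; apply/is_joinP => v.
by rewrite odd_degree_symdiff J_deg K_deg -addbA addKb.
Qed.

Lemma even_set_symdiff J K : even_set J -> even_set K -> even_set (symdiff J K).
Proof.
move=> /even_setP J_deg /even_setP K_deg; apply/even_setP => v.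
by rewrite odd_degree_symdiff J_deg K_deg.
Qed.

Lemma is_joinU x y z J K :
  [disjoint J & K] -> is_join x y J -> is_join y z K -> is_join x z (J :|: K).
Proof. by move=> /symdiff_disjoint <-; exact: is_join_symdiff. Qed.

Lemma is_joinD x y z J K :
  K \subset J -> is_join x y J -> is_join y z K -> is_join x z (J :\: K).
Proof. by move=> /symdiff_subset <-; exact: is_join_symdiff. Qed.

Lemma is_join_edge e : is_join (s e) (t e) [set e].
Proof. by apply/is_joinP => v; rewrite odd_degree1 /odd_end !(eq_sym v). Qed.

Lemma odd_end_join e v :
  odd_end e v -> exists2 u, u != v & is_join v u [set e].
Proof.
rewrite /odd_end; have [<-|s_v] /= := eqVneq (s e) v.
  by move=> t_s; exists (t e) => //; exact: is_join_edge.
move/eqP => t_v; exists (s e) => //; rewrite -t_v is_join_sym; exact: is_join_edge.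
Qed.

Lemma odd_end_of_join e u v :
  is_join v u [set e] -> u != v -> odd_end e =1 [pred x | (x == v) || (x == u)].
Proof.
move=> /is_joinP e_deg uv x; rewrite -odd_degree1 e_deg /=.
by have [->|] := eqVneq x v => //=; rewrite eq_sym (negPf uv).
Qed.

Lemma join_single_end v J x : x != v -> is_join x v J ->
  exists J' e, [/\ J' \subset J, is_join x v J' & star J' v = [set e]].
Proof.
have [n] := ubnP #|J|; elim: n J x => // n IH J x leJ xv Jxv.
have [a] : exists a, a \in star J x.
  by apply: odd_degree_star; rewrite (is_joinP _ _ _ Jxv) eqxx (negPf xv).
rewrite inE => /andP[aJ ax]; have [z zx axz] := odd_end_join ax.
have sa : [set a] \subset J by rewrite sub1set.
have [zv|zv] := eqVneq z v.
  exists [set a], a; rewrite zv in zx axz; split=> //; apply/setP => f.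
  rewrite !inE; case: eqP => // ->.
  by rewrite (odd_end_of_join axz zx) /= eqxx orbT.
have Jzv : is_join z v (J :\ a).
  by rewrite is_join_sym; apply: is_joinD sa _ axz; rewrite is_join_sym.
have [|J' [e [sJ' J'zv J'v]]] := IH _ _ _ zv Jzv; first by rewrite (cardsD1 a) aJ in leJ.
move: sJ'; rewrite subsetD1 => /andP[sJ' aJ'].
exists (a |: J'), e; split.
- by rewrite subUset sa.
- by apply: is_joinU axz J'zv; rewrite disjoints1.
rewrite -J'v; apply/setP => f; rewrite !inE; case: eqP => // ->.
rewrite (odd_end_of_join axz zx) /= eq_sym (negPf xv) eq_sym (negPf zv).
by rewrite andbF.
Qed.

Lemma odd_degree_sum J : \big[addb/false]_v odd_degree J v = false.
Proof.
by rewrite exchange_big big1 // => e _; rewrite big_split /= !big_addb_eq.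
Qed.

Definition reachable K v y := [exists A : {set E}, (A \subset K) && is_join v y A].

Lemma reachableP K v y :
  reflect (exists2 A : {set E}, A \subset K & is_join v y A) (reachable K v y).
Proof.
apply: (iffP existsP) => [[A /andP[sA Avy]]|[A sA Avy]]; exists A => //.
by rewrite sA.
Qed.

Lemma reachablexx K v : reachable K v v.
Proof. by apply/reachableP; exists set0; rewrite ?sub0set ?is_joinxx ?even_set0. Qed.

Lemma reachable_edge K v e : e \in K -> reachable K v (s e) = reachable K v (t e).
Proof.
move=> eK; have extend y z : is_join y z [set e] -> reachable K v y -> reachable K v z.
  move=> e_yz /reachableP[A sA Avy]; apply/reachableP; exists (symdiff A [set e]).
    apply/subsetP => f; rewrite !inE; case: eqP => [->//|_].
    by rewrite addbF; exact: (subsetP sA).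
  exact: is_join_symdiff Avy e_yz.
by apply/idP/idP; apply: extend; last rewrite is_join_sym; exact: is_join_edge.
Qed.

Definition component K v := [set e in K | reachable K v (s e)].

Lemma odd_degree_component K v y :
  odd_degree (component K v) y = reachable K v y && odd_degree K y.
Proof.
transitivity (\big[addb/false]_(e in K) (reachable K v y && odd_end e y)); last first.
  by case: (reachable K v y) => //; rewrite big1.
rewrite /odd_degree big_mkcond [RHS]big_mkcond; apply: eq_bigr => e _.
rewrite inE; case eK : (e \in K) => //=.
rewrite /odd_end; have [<-|_] := eqVneq (s e) y; first by case: (reachable _ _ _).
have [<-|_] := eqVneq (t e) y; last by rewrite andbF if_same.
by rewrite (reachable_edge v eK); case: (reachable _ _ _).
Qed.

Lemma odd_degree_other_end K v : odd_degree K v ->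
  exists x J, [/\ x != v, odd_degree K x, J \subset K & is_join x v J].
Proof.
move=> Kv; have [x /andP[xv]|no_x] := pickP [pred x | (x != v) && odd_degree (component K v) x].
  rewrite odd_degree_component => /andP[/reachableP[A sA Avx] Kx].
  by exists x, A; rewrite is_join_sym.
have := odd_degree_sum (component K v); rewrite (bigD1 v) //=.
rewrite odd_degree_component reachablexx Kv big1 // => x xv.
by have := no_x x; rewrite /= xv.
Qed.

(** ** Circuits *)

Definition circuit := minimal_nonempty even_set.

Lemma circuit_star C f v : circuit C -> f \in star C v ->
  exists2 f', f' != f & star C v = [set f; f'].
Proof.
move=> /minimal_nonemptyP[C_even _ C_min]; rewrite inE => /andP[fC fv].
have [u uv f_vu] := odd_end_join fv; have sf : [set f] \subset C by rewrite sub1set.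
have Cf_uv : is_join u v (C :\ f).
  by rewrite is_join_sym; apply: is_joinD sf _ f_vu; rewrite is_joinxx.
have [J [e [sJ J_uv Jv]]] := join_single_end uv Cf_uv.
move: sJ; rewrite subsetD1 => /andP[sJ fJ].
have fJ_C : f |: J = C.
  apply: C_min; last by apply/set0Pn; exists f; rewrite setU11.
    by rewrite -(is_joinxx v); apply: is_joinU f_vu J_uv; rewrite disjoints1.
  by rewrite subUset sf.
have /setP Jv_e := Jv; exists e.
  by apply: contraNneq fJ => <-; have := Jv_e e; rewrite !inE eqxx => /andP[].
apply/setP => h; have := Jv_e h; rewrite -fJ_C !inE.
by have [->|_] := eqVneq h f => [_|->] //; rewrite fv.
Qed.

Lemma circuit_connected C f h v x : circuit C -> f \in star C v -> h \in star C x ->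
  exists2 A : {set E}, A \subset C & is_join v x A.
Proof.
move=> /minimal_nonemptyP[C_even _ C_min]; rewrite !inE => /andP[fC fv] /andP[hC hx].
have reachable_end e y : e \in C -> odd_end e y -> reachable C v y = (e \in component C v).
  move=> eC; rewrite inE eC /odd_end; have [<-//|_] := eqVneq (s e) y.
  by move=> /eqP <-; rewrite (reachable_edge v eC).
apply/reachableP; rewrite (reachable_end h) // (_ : component C v = C) //.
apply: C_min; last by apply/set0Pn; exists f; rewrite -(reachable_end f v) ?reachablexx.
  apply/even_setP => y; rewrite odd_degree_component.
  by rewrite (even_setP _ C_even) andbF.
by apply/subsetP => e; rewrite inE => /andP[].
Qed.

End Joins.

Section Pushforward.
Variables (V V' E : finType) (s t : E -> V) (h : V -> V').
Implicit Types (J : {set E}) (x : V').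

Lemma odd_degree_comp J x :
  odd_degree (h \o s) (h \o t) J x = \big[addb/false]_(v | h v == x) odd_degree s t J v.
Proof.
rewrite exchange_big; apply: eq_bigr => e _.
by rewrite big_split /= !big_addb_eq.
Qed.

Lemma even_set_comp J : even_set s t J -> even_set (h \o s) (h \o t) J.
Proof.
move=> /even_setP J_even; apply/even_setP => x.
by rewrite odd_degree_comp big1.
Qed.

End Pushforward.

Lemma even_set_crossing (V E : finType) (s t : E -> V) (J : {set E}) (h : pred V) :
  even_set s t J -> \big[addb/false]_(e in J) (h (s e) (+) h (t e)) = false.
Proof.
move=> /(even_set_comp h)/even_setP/(_ true); apply: etrans.
by apply: eq_bigr => e _; rewrite /odd_end !eqb_id.
Qed.

(** * Conservative weightings and sums of circuits *)

Section Weights.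
Variables (R : comPzRingType) (E : finType).
Implicit Types (w q : E -> R) (C D : {set E}).

Definition wt w C : R := \sum_(e in C) w e.

Lemma wt0 w : wt w set0 = 0.
Proof. exact: big_set0. Qed.

Lemma wt1 w e : wt w [set e] = w e.
Proof. exact: big_set1. Qed.

Lemma wtU w C D : [disjoint C & D] -> wt w (C :|: D) = wt w C + wt w D.
Proof. by move=> CD; rewrite /wt -bigU //; apply: eq_bigl => e; rewrite !inE. Qed.

Lemma wtD w C D : D \subset C -> wt w (C :\: D) = wt w C - wt w D.
Proof.
by move=> DC; rewrite /wt [X in _ = X - _](big_setID D) /= (setIidPr DC) addrC addrK.
Qed.

Lemma wtBZ w q k C : wt (fun e => w e - k * q e) C = wt w C - k * wt q C.
Proof. by rewrite /wt mulr_sumr sumrB. Qed.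

Lemma wt_indicator w C : wt w C = dot w (fun e => (e \in C)%:R).
Proof.
by rewrite /wt big_mkcond; apply: eq_bigr => e _; case: (e \in C); rewrite ?mulr1 ?mulr0.
Qed.

End Weights.

Section Separation.
Variable V : finType.
Implicit Types (S : {set V}) (u v z : V).

Definition sep S u v := (u \in S) (+) (v \in S).

Lemma sepxx S u : sep S u u = false.
Proof. exact: addbb. Qed.

Lemma sep_sym S u v : sep S u v = sep S v u.
Proof. exact: addbC. Qed.

Lemma sep_addb v S u z : sep S u z = sep S u v (+) sep S v z.
Proof. by rewrite /sep -addbA addKb. Qed.

Lemma sep_symdiff S S' u v : sep (symdiff S S') u v = sep S u v (+) sep S' u v.
Proof. by rewrite /sep !inE; do 4 case: (_ \in _). Qed.

End Separation.

Section Conservative.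
Variables (R : realFieldType) (V E : finType).
Implicit Types (s t : E -> V) (w d : E -> R) (C : {set E}) (X : {set V}).

Definition edge_cut s t X : {set E} := [set e | sep X (s e) (t e)].
Definition conservative s t w := forall C, even_set s t C -> 0 <= wt w C.
Definition cut_dominated s t d :=
  forall X e, e \in edge_cut s t X -> d e <= wt d (edge_cut s t X :\ e).

Lemma cut_dominated_comp s t d (h : V -> V) :
  cut_dominated s t d -> cut_dominated (h \o s) (h \o t) d.
Proof.
move=> d_dom X; suff -> : edge_cut (h \o s) (h \o t) X = edge_cut s t (h @^-1: X).
  exact: d_dom.
by apply/setP => e; rewrite inE [RHS]inE /sep !inE.
Qed.

End Conservative.

Section Contraction.
Variables (R : realFieldType) (V E : finType) (s t : E -> V) (f : E).
Hypothesis f_nloop : s f != t f.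

Definition contract v := if v == t f then s f else v.

Lemma even_set_contract C : even_set (contract \o s) (contract \o t) C ->
  even_set s t C \/ even_set s t (symdiff C [set f]).
Proof.
move=> /even_setP C_even.
have outside v : v != s f -> v != t f -> odd_degree s t C v = false.
  move=> /negPf vs /negPf vt; rewrite -(C_even v) odd_degree_comp (big_pred1 v) // => u.
  rewrite /contract /=; case: (u =P t f) => // ->.
  by rewrite [RHS]eq_sym vt eq_sym.
have same_parity : odd_degree s t C (s f) = odd_degree s t C (t f).
  have := C_even (s f); rewrite odd_degree_comp (bigD1 (t f)) /=; last by rewrite /contract !eqxx.
  rewrite (big_pred1 (s f)) => [|u]; first by do 2 case: (odd_degree _ _ _ _).
  rewrite /contract /=; case: (eqVneq u (t f)) => [->|]; last by rewrite andbT.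
  by rewrite eqxx eq_sym (negPf f_nloop).
case s_odd : (odd_degree s t C (s f)); [right|left]; apply/even_setP => v.
  rewrite odd_degree_symdiff odd_degree1 /odd_end.
  have [->|v_s] := eqVneq v (s f); first by rewrite s_odd eq_sym (negPf f_nloop).
  have [->|v_t] := eqVneq v (t f); first by rewrite -same_parity s_odd.
  by rewrite outside.
have [->//|v_s] := eqVneq v (s f).
by have [->|v_t] := eqVneq v (t f); [rewrite -same_parity|exact: outside].
Qed.

Lemma conservative_contract (w : E -> R) : w f = 0 -> conservative s t w ->
  conservative (contract \o s) (contract \o t) w.
Proof.
move=> wf w_cons C /even_set_contract[/w_cons //|/w_cons].
congr (0 <= _); rewrite /wt big_mkcond [RHS]big_mkcond; apply: eq_bigr => e _.
by rewrite !inE; case: eqP => [->|_]; rewrite ?addbF // wf !if_same.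
Qed.

Lemma card_nloop_contract :
  (#|[set e | (contract \o s) e != (contract \o t) e]| < #|[set e | s e != t e]|)%N.
Proof.
apply: proper_card; apply/properP; split.
  by apply/subsetP => e; rewrite !inE /=; apply: contraNneq => ->.
by exists f; rewrite !inE //= /contract eqxx (negPf f_nloop) eqxx.
Qed.

End Contraction.

Section Pivot.
Variables (R : realFieldType) (V E : finType) (s t : E -> V) (w : E -> R).
Hypothesis w_conservative : conservative s t w.
Implicit Types (x v : V) (e f : E) (C J K : {set E}).
Local Notation is_join := (is_join s t).

(* Such a join ends in a single edge, which is negative, while all other edges at
   that end are positive. *)
Definition minimal_join x v J := [/\ is_join x v J,
  forall x' v' J', is_join x' v' J' -> wt w J <= wt w J' &
  forall x' v' J', is_join x' v' J' -> wt w J' <= wt w J -> (#|J| <= #|J'|)%N].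

Lemma minimal_join_exists e : w e < 0 -> exists x v J, minimal_join x v J /\ wt w J < 0.
Proof.
move=> we; pose joins := [pred p : V * V * {set E} | is_join p.1.1 p.1.2 p.2].
have joins_e : joins (s e, t e, [set e]) by exact: is_join_edge.
case: (arg_minP (fun p : V * V * {set E} => wt w p.2) joins_e) => p joins_p p_min.
pose lightest := [pred p' | joins p' && (wt w p'.2 <= wt w p.2)].
have lightest_p : lightest p by apply/andP.
case: (arg_minnP (fun p' : V * V * {set E} => #|p'.2|) lightest_p).
move=> [[x v] J] /andP[/= J_join J_p] J_min; exists x, v, J; split; last first.
  by apply: le_lt_trans J_p _; apply: le_lt_trans (p_min _ joins_e) _; rewrite wt1.
split=> // x' v' J' J'_join; first exact: le_trans J_p (p_min (x', v', J') J'_join).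
move=> J'J; apply: (J_min (x', v', J')); apply/andP; split=> //.
exact: le_trans J'J J_p.
Qed.

Section MinimalJoin.
Variables (x v : V) (J : {set E}).
Hypothesis J_min : minimal_join x v J.
Hypothesis J_neg : wt w J < 0.

Let J_join : is_join x v J. Proof. by case: J_min. Qed.
Let J_lightest x' v' J' : is_join x' v' J' -> wt w J <= wt w J'.
Proof. by case: J_min => _ lightest _; exact: lightest. Qed.

Lemma minimal_join_neq : x != v.
Proof.
by apply: contraTneq J_neg => xv; rewrite -leNgt w_conservative // -(is_joinxx _ _ v) -{1}xv.
Qed.

Lemma minimal_join_delete x' v' K : K \subset J -> K != set0 ->
  is_join x' v' (J :\: K) -> wt w K < 0.
Proof.
move=> sK K0 JK_join; rewrite ltNge; apply/negP => wK.
have [_ _ /(_ _ _ _ JK_join)] := J_min; rewrite wtD // gerBl => /(_ wK).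
rewrite cardsD (setIidPr sK); have := subset_leq_card sK.
by rewrite -card_gt0 in K0; lia.
Qed.

Lemma minimal_join_sub J' : J' \subset J -> is_join x v J' -> J' = J.
Proof.
move=> sJ' J'_join; have JJ' : even_set s t (J :\: J').
  by rewrite -(is_joinxx _ _ x); apply: is_joinD sJ' J_join _; rewrite is_join_sym.
apply/eqP; rewrite eqEsubset sJ' -setD_eq0; apply: contraTT (w_conservative JJ') => JJ'0.
rewrite -ltNge; apply: (minimal_join_delete (x' := x) (v' := v)) => //; first exact: subsetDl.
by rewrite setDDr setDv set0U (setIidPr sJ').
Qed.

Lemma minimal_join_end : exists e, star s t J v = [set e].
Proof.
have [J' [e [sJ' J'_join J'v]]] := join_single_end minimal_join_neq J_join.
by exists e; rewrite -(minimal_join_sub sJ' J'_join).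
Qed.

Lemma minimal_join_end_neg e : e \in star s t J v -> w e < 0.
Proof.
rewrite inE => /andP[eJ ev]; have [u _ e_vu] := odd_end_join ev.
have se : [set e] \subset J by rewrite sub1set.
rewrite -(wt1 w e); apply: minimal_join_delete se _ (is_joinD se J_join e_vu).
by apply/set0Pn; exists e; rewrite set11.
Qed.

Lemma minimal_join_adj_ge0 f : odd_end s t f v -> f \notin J -> 0 <= w f.
Proof.
move=> fv fJ; have [u _ f_vu] := odd_end_join fv.
have Jf : [disjoint J & [set f]] by rewrite disjoint_sym disjoints1.
by have := J_lightest (is_joinU Jf J_join f_vu); rewrite wtU // wt1 lerDl.
Qed.

Lemma tight_circuit_meets C f : circuit s t C -> wt w C = 0 -> f \in star s t C v ->
  0 < w f -> ~~ [disjoint J & C].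
Proof.
move=> /minimal_nonemptyP[C_even _ _] wC; rewrite inE => /andP[fC fv] wf.
have [u _ f_vu] := odd_end_join fv; apply/negP => JC.
have JC_join : is_join x v (J :|: C) by apply: is_joinU JC J_join _; rewrite is_joinxx.
have sf : [set f] \subset J :|: C by rewrite sub1set inE fC orbT.
have := J_lightest (is_joinD sf JC_join f_vu).
by rewrite wtD // wtU // wC wt1 addr0 lerDl oppr_ge0 leNgt wf.
Qed.

(* Together with either of the two arcs of [C] the join [K] closes up, and the
   two arcs have total weight 0. *)
Lemma tight_circuit_no_ear C f h x' K : circuit s t C -> wt w C = 0 ->
    f \in star s t C v -> h \in star s t C x' -> K \subset J -> [disjoint K & C] ->
  is_join x' v K -> x' = v.
Proof.
move=> C_circ wC fC hC sK KC K_join; apply/eqP/negPn/negP => x'v.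
have [C_even _ _] := minimal_nonemptyP C_circ.
have [A sA A_join] := circuit_connected C_circ fC hC.
have wKA : 0 <= wt w K + wt w A.
  have KA := disjointWr sA KC; rewrite -wtU // w_conservative // -(is_joinxx _ _ x').
  exact: is_joinU KA K_join A_join.
have wKCA : 0 <= wt w K + wt w (C :\: A).
  have KCA := disjointWr (subsetDl C A) KC; rewrite -wtU // w_conservative //.
  rewrite -(is_joinxx _ _ x'); apply: is_joinU KCA K_join _.
  by apply: is_joinD sA _ A_join; rewrite is_joinxx.
have : wt w K < 0.
  apply: (@minimal_join_delete x x') => //; last first.
    by apply: is_joinD sK J_join _; rewrite is_join_sym.
  apply: contraTneq K_join => ->; apply/negP => /is_joinP/(_ x').
  by rewrite odd_degree0 eqxx (negPf x'v).
by rewrite wtD // wC in wKCA; lra.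
Qed.

Lemma tight_circuit_end C e f : circuit s t C -> wt w C = 0 -> f \in star s t C v ->
  0 < w f -> star s t J v = [set e] -> e \in C.
Proof.
move=> C_circ wC fC wf Jv; apply: contraNT (tight_circuit_meets C_circ wC fC wf) => eC.
have /setIdP[eJ ev] : e \in star s t J v by rewrite Jv set11.
have JCv : odd_degree s t (J :\: C) v.
  rewrite (eq_odd_degree (K := J)); last first.
    by rewrite starD Jv; apply/setDidPl; rewrite disjoints1 inE (negPf eC).
  by rewrite (is_joinP _ _ _ _ _ J_join) eqxx addbT eq_sym minimal_join_neq.
have [x' [K [x'v JCx' sK K_join]]] := odd_degree_other_end JCv.
move: sK; rewrite subsetD => /andP[sK KC].
have [h hC|C_x'] := pickP [in star s t C x'].
  by rewrite (tight_circuit_no_ear C_circ wC fC hC sK KC K_join) eqxx in x'v.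
have x'x : x' = x.
  have C_x'0 : star s t C x' = set0 by apply/setP => h; rewrite C_x' inE.
  move: JCx'; rewrite (eq_odd_degree (K := J)) ?starD ?C_x'0 ?setD0 //.
  by rewrite (is_joinP _ _ _ _ _ J_join) (negPf x'v) addbF => /eqP.
by rewrite -(minimal_join_sub sK) // -x'x.
Qed.

End MinimalJoin.

Definition is_pivot v e := [/\ odd_end s t e v, w e < 0,
  forall f, odd_end s t f v -> f != e -> 0 < w f &
  forall C f, circuit s t C -> wt w C = 0 -> f \in star s t C v -> e \in C].

Lemma pivot_exists : (forall e, s e != t e -> w e != 0) -> (exists e, w e < 0) ->
  exists v e, is_pivot v e.
Proof.
move=> w_neq0 [a wa]; have [x [v [J [J_min J_neg]]]] := minimal_join_exists wa.
have [e Jv] := minimal_join_end J_min J_neg; exists v, e.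
have eJv : e \in star s t J v by rewrite Jv set11.
have w_pos f : odd_end s t f v -> f != e -> 0 < w f.
  move=> fv fe; rewrite lt0r w_neq0 ?(odd_end_nloop fv) //=.
  apply: (minimal_join_adj_ge0 J_min fv).
  by apply: contra fe => fJ; rewrite -in_set1 -Jv inE fJ.
split=> //; first by move: eJv; rewrite inE => /andP[].
  exact: (minimal_join_end_neg J_min J_neg eJv).
move=> C f C_circ wC fC; have [<-|fe] := eqVneq f e; first by case/setIdP: fC.
apply: (tight_circuit_end J_min J_neg C_circ wC fC _ Jv).
by apply: w_pos => //; case/setIdP: fC.
Qed.

End Pivot.

Section PivotShift.
Variables (R : realFieldType) (V E : finType) (s t : E -> V).
Variables (w : E -> R) (v : V) (e : E).
Hypothesis w_conservative : conservative s t w.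
Hypothesis e_pivot : is_pivot s t w v e.
Implicit Types (C : {set E}) (f : E) (d : E -> R).

Definition pivot_shift f : R := if f == e then -1 else (odd_end s t f v)%:R.

Lemma pivot_shift_out f : ~~ odd_end s t f v -> pivot_shift f = 0.
Proof.
have [ev _ _ _] := e_pivot; rewrite /pivot_shift => /negPf fv.
by case: eqP fv => [->|_ ->//]; rewrite ev.
Qed.

Lemma pivot_shift_in f : odd_end s t f v -> f != e -> pivot_shift f = 1.
Proof. by rewrite /pivot_shift => -> /negPf ->. Qed.

Lemma wt_pivot_shift_star C : wt pivot_shift C = wt pivot_shift (star s t C v).
Proof.
rewrite /wt (bigID (odd_end s t ^~ v)) /= [X in _ + X]big1 ?addr0.
  by apply: eq_bigl => f; rewrite inE.
by move=> f /andP[_ /pivot_shift_out].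
Qed.

Lemma wt_pivot_shift_circuit C : circuit s t C ->
  wt pivot_shift C = 0 \/ 0 < wt w C.
Proof.
move=> C_circ; have [ev _ _ tight] := e_pivot.
have [C_even _ _] := minimal_nonemptyP C_circ.
have [f fC|Cv0] := pickP [in star s t C v]; last first.
  by left; rewrite wt_pivot_shift_star /wt big_pred0.
have [eC|eC] := boolP (e \in C); last first.
  right; rewrite lt0r w_conservative // andbT; apply: contraNneq eC => wC.
  exact: tight C_circ wC fC.
left; have [|f' f'e Cv] := circuit_star C_circ (f := e) (v := v); first by rewrite inE eC.
have /setIdP[_ f'v] : f' \in star s t C v by rewrite Cv set22.
rewrite wt_pivot_shift_star Cv wtU ?disjoints1 ?inE 1?eq_sym // !wt1.
by rewrite (pivot_shift_in f'v f'e) /pivot_shift eqxx addNr.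
Qed.

Lemma tight_wt_pivot_shift C : even_set s t C -> wt w C = 0 -> wt pivot_shift C = 0.
Proof.
suff tight_shift : forall D, even_set s t D ->
  0 <= wt w D /\ (wt w D = 0 -> wt pivot_shift D = 0) by case/tight_shift.
apply: symdiff_closed_ind => [A B||A B A_circ B_even AB [wB qB]].
- exact: even_set_symdiff.
- by rewrite !wt0.
have [A_even _ _] := minimal_nonemptyP A_circ; have wA := w_conservative A_even.
rewrite !wtU //; split=> [|wAB]; first exact: addr_ge0.
rewrite qB ?addr0; last lra.
by have [//|wA_pos] := wt_pivot_shift_circuit A_circ; lra.
Qed.

Lemma dot_pivot_shift_ge0 d : cut_dominated s t d -> 0 <= dot pivot_shift d.
Proof.
have [ev _ _ _] := e_pivot; move=> /(_ [set v] e).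
have star_v : edge_cut s t [set v] = star s t setT v by apply/setP => f; rewrite inE /sep !inE.
rewrite star_v !inE ev => /(_ isT) d_e.
rewrite /dot (bigD1 e) //= {1}/pivot_shift eqxx mulN1r addrC subr_ge0.
suff -> : \sum_(f | f != e) pivot_shift f * d f = wt d (star s t [set: E] v :\ e) by [].
rewrite /wt big_mkcond [RHS]big_mkcond; apply: eq_bigr => f _; rewrite !inE /=.
case: (eqVneq f e) => //= fe; have [fv|/pivot_shift_out ->] := boolP (odd_end s t f v).
  by rewrite pivot_shift_in ?mul1r.
by rewrite mul0r.
Qed.

End PivotShift.

Section SumsOfCircuits.
Variables (R : realFieldType) (V E : finType).
Implicit Types (s t : E -> V) (w d : E -> R) (C : {set E}).

Definition slack s t w (c : {set E} + E) : R :=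
  match c with inl C => if even_set s t C then wt w C else 0 | inr f => `|w f| end.

(* The shift at the pivot goes on until one more slack vanishes. *)
Lemma conservative_pivot_step s t w d : conservative s t w -> cut_dominated s t d ->
    (forall e, s e != t e -> w e != 0) -> (exists e, w e < 0) ->
  exists w', [/\ conservative s t w', dot w' d <= dot w d &
    (#|support (slack s t w')| < #|support (slack s t w)|)%N].
Proof.
move=> w_cons d_dom w_neq0 /(pivot_exists w_cons w_neq0)[v [e e_pivot]].
have [ev we w_pos _] := e_pivot; pose q := pivot_shift R s t v e.
pose slope (c : {set E} + E) : R := match c with
  | inl C => if even_set s t C then wt q C else 0 | inr f => (odd_end s t f v)%:R end.
have [|||k k_ge0 [slack_ge0 card_lt]] := @ratio_test R _ (slack s t w) slope.
- by case=> [C|f] /=; [case: ifP => // /w_cons|].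
- case=> [C|f] /=; first by case: ifP => // C_even; exact: tight_wt_pivot_shift.
  move/eqP; rewrite normr_eq0; case fv : (odd_end s t f v) => // wf.
  by rewrite (negPf (w_neq0 f (odd_end_nloop fv))) in wf.
- by exists (inr e); rewrite /= ev ltr01.
pose w' f := w f - k * q f.
have slack_w' c : slack s t w' c = slack s t w c - k * slope c.
  case: c => [C|f] /=; first by case: ifP => _; rewrite ?wtBZ // mulr0 subr0.
  have := slack_ge0 (inr f); rewrite /= /w' /q.
  have [fv|fv] := boolP (odd_end s t f v); last first.
    by rewrite (pivot_shift_out e_pivot) // !mulr0 !subr0.
  rewrite mulr1; have [->|fe] := eqVneq f e => [|k_le].
    by rewrite /pivot_shift eqxx ltr0_norm // => ?; rewrite ler0_norm; lra.
  by rewrite pivot_shift_in // mulr1 (gtr0_norm (w_pos f fv fe)) in k_le *; rewrite ger0_norm.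
exists w'; split=> [C C_even||].
- by have := slack_ge0 (inl C); rewrite -slack_w' /= C_even.
- rewrite dotC dotBZr !(dotC d) gerBl.
  by rewrite mulr_ge0 // (dot_pivot_shift_ge0 e_pivot d_dom).
by rewrite (eq_card (B := support (fun c => slack s t w c - k * slope c))) // => c;
  rewrite !inE slack_w'.
Qed.

Lemma conservative_dot_ge0 s t w d : conservative s t w -> (forall e, 0 <= d e) ->
  cut_dominated s t d -> 0 <= dot w d.
Proof.
move=> w_cons d_ge0; have [n] := ubnP #|[set e | s e != t e]|.
elim: n s t w w_cons => // n IHn s t w w_cons leEn.
have [m] := ubnP #|support (slack s t w)|; elim: m w w_cons => // m IHm w w_cons lem d_dom.
have [[f f_nloop wf]|w_neq0] := pselect (exists2 f, s f != t f & w f = 0).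
  apply: (IHn (contract s t f \o s) (contract s t f \o t)).
  - exact: conservative_contract.
  - exact: leq_trans (card_nloop_contract f_nloop) _.
  - exact: cut_dominated_comp.
have [w_neg|w_ge0] := pselect (exists e, w e < 0); last first.
  apply: sumr_ge0 => e _; rewrite mulr_ge0 // leNgt; apply/negP => we.
  by apply: w_ge0; exists e.
have [|w' [w'_cons w'_le slack_lt]] := conservative_pivot_step w_cons d_dom _ w_neg.
  by move=> e e_nloop; apply/eqP => we; apply: w_neq0; exists e.
by apply: le_trans w'_le; apply: IHm => //; exact: leq_trans slack_lt _.
Qed.

(* Seymour's sums of circuits theorem; an even set is a disjoint union of circuits. *)
Theorem sums_of_circuits s t d : (forall e, 0 <= d e) -> cut_dominated s t d ->
  conic_comb (fun (C : {C : {set E} | even_set s t C}) e => (e \in val C)%:R) d.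
Proof.
move=> d_ge0 d_dom; apply: farkas => w w_cons.
apply: (conservative_dot_ge0 (s := s) (t := t)) => // C C_even.
by rewrite wt_indicator; exact: w_cons (exist _ C C_even).
Qed.

End SumsOfCircuits.

(** * Even sets of darts in a planar map *)

Section ClassMatrix.
Variables (F : fieldType) (T : finType) (e : rel T).
Hypothesis e_sym : connect_sym e.
Local Notation root := (fingraph.root e).
Implicit Types (u : 'rV[F]_#|T|) (x y : T) (k : 'I_#|roots e|).

Definition class_mx : 'M[F]_(#|roots e|, #|T|) :=
  \matrix_(i, j) (root (enum_val j) == enum_val i)%:R.

Lemma root_enum_val k : root (enum_val k) = enum_val k.
Proof. by have /eqP := enum_valP k. Qed.

Lemma root_index x : exists k, enum_val k = root x.
Proof.
have rx : root x \in roots e by exact: roots_root.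
by exists (enum_rank_in rx (root x)); rewrite enum_rankK_in.
Qed.

Lemma mul_class_mx (w : 'rV[F]_#|roots e|) x k :
  enum_val k = root x -> (w *m class_mx) 0 (enum_rank x) = w 0 k.
Proof.
move=> kx; rewrite mxE (bigD1 k) //= mxE enum_rankK kx eqxx mulr1.
rewrite big1 ?addr0 // => i ik; rewrite mxE enum_rankK -kx (inj_eq enum_val_inj).
by rewrite eq_sym (negPf ik) mulr0.
Qed.

Lemma class_mx_rank : \rank class_mx = n_comp e predT.
Proof.
have -> : n_comp e predT = #|roots e| by apply: eq_card => x; rewrite !inE andbT.
apply/eqP/inj_row_free => w w0; apply/rowP => k; rewrite mxE.
by rewrite -(@mul_class_mx w (enum_val k) k) ?root_enum_val // w0 mxE.
Qed.

Lemma class_mxP u : reflect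
  (forall x y, e x y -> u 0 (enum_rank x) = u 0 (enum_rank y)) (u <= class_mx)%MS.
Proof.
apply: (iffP idP) => [/submxP[w ->] x y xy|u_inv].
  have [k kx] := root_index x; rewrite !(mul_class_mx _ (k := k)) //.
  by rewrite kx; apply/(fingraph.rootP e_sym)/connect1.
have u_root x : u 0 (enum_rank x) = u 0 (enum_rank (root x)).
  have /connectP[p] := connect_root e x; move: (root x) => y.
  by elim: p x => [x _ -> //|z p IH x /= /andP[/u_inv -> ep] py]; exact: IH.
apply/submxP; exists (\row_k u 0 (enum_rank (enum_val k))); apply/rowP => j.
rewrite -[j]enum_valK; have [k kj] := root_index (enum_val j).
by rewrite (mul_class_mx _ kj) mxE kj u_root.
Qed.

Lemma mul_class_mx_tr u k :
  (u *m class_mx^T) 0 k = \sum_(y | root y == enum_val k) u 0 (enum_rank y).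
Proof.
rewrite mxE (reindex _ (onW_bij _ (@enum_rank_bij T))) [RHS]big_mkcond.
by apply: eq_bigr => y _; rewrite !mxE enum_rankK; case: ifP; rewrite ?mulr1 ?mulr0.
Qed.

Lemma mul_class_gram u x :
  (u *m (class_mx^T *m class_mx)) 0 (enum_rank x) =
  \sum_(y | connect e x y) u 0 (enum_rank y).
Proof.
have [k kx] := root_index x; rewrite mulmxA (mul_class_mx _ kx) mul_class_mx_tr kx.
by apply: eq_bigl => y; rewrite eq_sym root_connect.
Qed.

End ClassMatrix.

Lemma F2_addr_neq0 (x y : 'F_2) : (x + y != 0) = (x != 0) (+) (y != 0).
Proof. by case: x y => [[|[|//]] ?] [[|[|//]] ?]. Qed.

Lemma F2_addrr (x : 'F_2) : x + x = 0.
Proof. by apply/eqP; rewrite -[_ == _]negbK F2_addr_neq0 addbb. Qed.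

Lemma F2_sum_natr (I : finType) (P : pred I) (h : I -> bool) :
  \sum_(i | P i) (h i)%:R = (\big[addb/false]_(i | P i) h i)%:R :> 'F_2.
Proof.
symmetry; apply: (big_morph (fun b : bool => b%:R : 'F_2)) => // b c.
by case: b c => [] []; apply/val_inj.
Qed.

Lemma froot_connect (T : finType) (f : T -> T) x y :
  injective f -> (froot f x == froot f y) = fconnect f x y.
Proof. by move=> f_inj; rewrite (root_connect (fconnect_sym f_inj)). Qed.

Lemma froot_iter (T : finType) (f : T -> T) n x :
  injective f -> froot f (iter n f x) = froot f x.
Proof. by move=> f_inj; apply/esym/eqP; rewrite froot_connect // fconnect_iter. Qed.

Lemma froot_succ (T : finType) (f : T -> T) x : injective f -> froot f (f x) = froot f x.
Proof. exact: (froot_iter 1). Qed.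

Lemma involution_connect (T : finType) (v : T -> T) x y :
  involutive v -> fconnect v x y = (y \in [:: x; v x]).
Proof.
move=> vK; apply/idP/idP => [/iter_findex <-|]; last first.
  by rewrite !inE => /orP[] /eqP ->; [exact: connect0|exact: fconnect1].
elim: (findex _ _ _) => [|n]; rewrite ?mem_head //= !inE => /orP[] /eqP ->.
  by rewrite eqxx orbT.
by rewrite vK eqxx.
Qed.

Section Duality.
Variables (T : finType) (r v : T -> T).
Hypothesis r_inj : injective r.
Hypothesis vK : involutive v.
Hypothesis v_free : forall d, v d != d.
Let face d := r (v d).
Hypothesis euler : (fcard r predT + fcard v predT + fcard face predT =
   #|T| + 2 * n_comp (relU (frel r) (frel v)) predT)%N.
Implicit Types (u h : 'rV['F_2]_#|T|) (x y d : T) (f : T -> T).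

Let v_inj : injective v := can_inj vK.
Let face_inj : injective face := inj_comp r_inj v_inj.
Let rv_sym : connect_sym (relU (frel r) (frel v)) :=
  relU_sym (fconnect_sym r_inj) (fconnect_sym v_inj).

Local Notation orbit_mx f := (class_mx 'F_2 (frel f)).
Local Notation coboundary := ((orbit_mx v)^T *m orbit_mx v).

Lemma orbit_mxP f u : injective f -> reflect
  (forall x, u 0 (enum_rank (f x)) = u 0 (enum_rank x)) (u <= orbit_mx f)%MS.
Proof.
move=> f_inj; apply: (iffP (class_mxP (fconnect_sym f_inj) u)) => u_inv.
  by move=> x; apply/esym/u_inv/eqP.
by move=> x _ /eqP <-; rewrite u_inv.
Qed.

Lemma mul_coboundary u x :
  (u *m coboundary) 0 (enum_rank x) = u 0 (enum_rank x) + u 0 (enum_rank (v x)).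
Proof.
rewrite (mul_class_gram (fconnect_sym v_inj)).
rewrite (bigD1 x) ?connect0 //= (big_pred1 (v x)) // => y /=.
rewrite (involution_connect _ _ vK) !inE andb_orl andbN /=.
by case: eqP => // ->; rewrite v_free.
Qed.

Lemma orbit_mx_coboundary_rank f : injective f ->
    (forall h, (forall x, h 0 (enum_rank (f x)) = h 0 (enum_rank x)) ->
      (forall x, h 0 (enum_rank (v x)) = h 0 (enum_rank x)) ->
      forall x, h 0 (enum_rank (r x)) = h 0 (enum_rank x)) ->
  (fcard f predT <= \rank (orbit_mx f *m coboundary) +
    n_comp (relU (frel r) (frel v)) predT)%N.
Proof.
move=> f_inj fv_r; rewrite -(class_mx_rank 'F_2) -(mxrank_mul_ker _ coboundary).
rewrite leq_add2l -(class_mx_rank 'F_2); apply/mxrankS/rV_subP => u.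
rewrite sub_capmx => /andP[/(orbit_mxP _ f_inj) uf /sub_kermxP u_ker].
have uv x : u 0 (enum_rank (v x)) = u 0 (enum_rank x).
  have := mul_coboundary u x; rewrite u_ker mxE => /(congr1 (+%R^~ (u 0 (enum_rank (v x))))).
  by rewrite add0r -addrA F2_addrr addr0.
by apply/(class_mxP rv_sym) => x y /orP[] /eqP <-; apply/esym; [exact: fv_r|exact: uv].
Qed.

Let cuts := orbit_mx r *m coboundary.
Let face_even := (orbit_mx v :&: kermx (orbit_mx face)^T)%MS.

Lemma cuts_sub_face_even : (cuts <= face_even)%MS.
Proof.
apply/rV_subP => u /submxP[w ->]; rewrite mulmxA; set h := w *m _.
have /(orbit_mxP _ r_inj) hr : (h <= orbit_mx r)%MS by exact: submxMl.
rewrite sub_capmx {1}mulmxA submxMl /=; apply/sub_kermxP/rowP => k.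
rewrite mul_class_mx_tr mxE.
under eq_bigr do rewrite mul_coboundary -[X in _ + X]hr.
rewrite big_split /= [X in X + _](reindex_inj face_inj) /=.
by under eq_bigl do rewrite froot_succ //; exact: F2_addrr.
Qed.

Lemma face_even_sub_cuts : (face_even <= cuts)%MS.
Proof.
have /leqifP := mxrank_leqif_sup cuts_sub_face_even; case: ifP => // _ rank_lt.
have V_le := orbit_mx_coboundary_rank r_inj (fun h hr _ => hr).
have F_le : (fcard face predT <= \rank (orbit_mx v *m (orbit_mx face)^T) +
    n_comp (relU (frel r) (frel v)) predT)%N.
  have := orbit_mx_coboundary_rank face_inj _; rewrite mulmxA => F_le.
  apply: leq_trans (F_le _) _ => [h hf hv x|]; first by rewrite -{1}(vK x) (hf (v x)) hv.
  rewrite leq_add2r (leq_trans (mxrankM_maxl _ _)) //.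
  by rewrite -mxrank_tr trmx_mul trmxK.
have E_eq := mxrank_mul_ker (orbit_mx v) (orbit_mx face)^T.
rewrite class_mx_rank -/face_even in E_eq.
have darts2 : (fcard v predT * 2 = #|T|)%N.
  apply: (fcard_order_set v_inj); last by move=> x y.
  apply/subsetP => x _; rewrite inE; apply/eqP.
  by apply: (@order_cycle _ _ [:: x; v x]); rewrite /= ?vK ?eqxx ?inE ?eqxx // eq_sym v_free.
move: V_le F_le E_eq darts2 rank_lt euler; rewrite -/cuts.
move: (\rank _) (\rank cuts) (\rank face_even).
by move: #|T| (fcard r _) (fcard v _) (fcard face _) (n_comp (relU _ _) _); lia.
Qed.

Theorem face_even_coboundary (C : {set T}) : (forall d, (v d \in C) = (d \in C)) ->
    (forall x, \big[addb/false]_(d in C) (froot face d == x) = false) ->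
  exists2 h : T -> bool, (forall d, h (r d) = h d) &
    forall d, (d \in C) = h d (+) h (v d).
Proof.
move=> C_v C_face; pose c : 'rV['F_2]_#|T| := \row_j (enum_val j \in C)%:R.
have cE d : c 0 (enum_rank d) = (d \in C)%:R by rewrite mxE enum_rankK.
have : (c <= face_even)%MS.
  rewrite sub_capmx; apply/andP; split; first by apply/(orbit_mxP _ v_inj) => d; rewrite !cE C_v.
  apply/sub_kermxP/rowP => k; rewrite mul_class_mx_tr mxE.
  transitivity ((\big[addb/false]_(d in C) (froot face d == enum_val k))%:R : 'F_2).
    rewrite -F2_sum_natr big_mkcond [RHS]big_mkcond; apply: eq_bigr => d _.
    by rewrite cE; case: (d \in C); case: eqP.
  by rewrite C_face.
move=> /submx_trans/(_ face_even_sub_cuts)/submxP[w]; rewrite mulmxA; set h := w *m _ => c_h.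
have /(orbit_mxP _ r_inj) hr : (h <= orbit_mx r)%MS by exact: submxMl.
exists (fun d => h 0 (enum_rank d) != 0) => d; first by rewrite hr.
rewrite -F2_addr_neq0 -mul_coboundary -c_h cE.
by case: (d \in C).
Qed.

End Duality.

(** * Graph distances *)

(* The triangle inequality holds only inside the classes of [conn], because
   [graph_dist] is 0 between different components. *)
Record semimetric_on (R : numDomainType) (V : Type) (conn : rel V) (d : V -> V -> R) : Prop :=
  SemimetricOn {
    conn_refl : reflexive conn;
    conn_sym : symmetric conn;
    conn_trans : transitive conn;
    semimetricxx : forall u, d u u = 0;
    semimetric_sym : forall u v, d u v = d v u;
    semimetric_ge0 : forall u v, 0 <= d u v;
    semimetric_triangle : forall u v x, conn u v -> conn v x -> d u x <= d u v + d v x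
  }.

Section Distance.
Variables (R : realType) (G : sgraph) (l : G -> G -> R).
Hypothesis l_sym : forall u v : G, adj u v -> l u v = l v u.
Hypothesis l_pos : forall u v : G, adj u v -> 0 < l u v.
Local Notation dist := (graph_dist l).
Local Notation connected := (connect (@adj G)).
Implicit Types (u v x z : G) (p q : seq G).

Lemma connected_sym : connect_sym (@adj G).
Proof. exact: sym_connect_sym (@adj_sym G). Qed.

Lemma connected_walkP u v : reflect (exists p, walk u v p) (connected u v).
Proof.
apply: (iffP connectP) => [[p up ->]|[p /andP[up /eqP <-]]]; exists p => //.
by rewrite /walk up eqxx.
Qed.

Lemma walk_last u p : path (@adj G) u p -> walk u (last u p) p.
Proof. by move=> up; rewrite /walk up eqxx. Qed.

Lemma walk_cat u v p q : walk u v (p ++ q) = walk u (last u p) p && walk (last u p) v q.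
Proof. by rewrite /walk cat_path last_cat eqxx andbT andbA. Qed.

Lemma walk_edges_cons u z p : walk_edges u (z :: p) = (u, z) :: walk_edges z p.
Proof. by []. Qed.

Lemma walk_edges_cat u p q :
  walk_edges u (p ++ q) = walk_edges u p ++ walk_edges (last u p) q.
Proof. by elim: p u => [|z p IH] u //=; rewrite walk_edges_cons IH. Qed.

Lemma walk_length_nil u : walk_length l u [::] = 0.
Proof. by rewrite /walk_length big_nil. Qed.

Lemma walk_length_cons u z p : walk_length l u (z :: p) = l u z + walk_length l z p.
Proof. by rewrite /walk_length walk_edges_cons big_cons. Qed.

Lemma walk_length_cat u p q :
  walk_length l u (p ++ q) = walk_length l u p + walk_length l (last u p) q.
Proof. by rewrite /walk_length walk_edges_cat big_cat. Qed.

Lemma walk_edges_iota (f : nat -> G) i n :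
  walk_edges (f i) [seq f k | k <- iota i.+1 n] = [seq (f k, f k.+1) | k <- iota i n].
Proof. by elim: n i => //= n IH i; rewrite walk_edges_cons IH. Qed.

Lemma walk_length_iota (f : nat -> G) i j :
  walk_length l (f i) [seq f k | k <- iota i.+1 (j - i)] = \sum_(i <= k < j) l (f k) (f k.+1).
Proof. by rewrite /walk_length walk_edges_iota big_map. Qed.

Lemma walk_iota (f : nat -> G) i j : (forall k, adj (f k) (f k.+1)) -> (i <= j)%N ->
  walk (f i) (f j) [seq f k | k <- iota i.+1 (j - i)].
Proof.
move=> f_adj /subnKC <-; rewrite addKn; move: (j - i)%N => n.
elim: n i => [|n IH] i.
  by rewrite addn0 /walk /= eqxx.
by have := IH i.+1; rewrite /walk /= f_adj addSnnS.
Qed.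

Lemma walk_length_ge0 u p : path (@adj G) u p -> 0 <= walk_length l u p.
Proof.
elim: p u => [|z p IH] u /=; first by rewrite walk_length_nil.
by case/andP => uz /IH zp; rewrite walk_length_cons addr_ge0 // ltW // l_pos.
Qed.

Lemma walk_length_gt0 u p : path (@adj G) u p -> p != [::] -> 0 < walk_length l u p.
Proof.
case: p => //= z p /andP[uz zp] _.
by rewrite walk_length_cons ltr_pwDl ?l_pos ?walk_length_ge0.
Qed.

Lemma walk_rev u v p : walk u v p -> walk v u (rev (belast u p)).
Proof.
rewrite /walk => /andP[up /eqP <-]; rewrite rev_path.
rewrite (@eq_path _ _ (@adj G)) => [|x z]; last exact: adj_sym.
by rewrite up; case: p {up} => //= z p; rewrite rev_cons last_rcons.
Qed.

Lemma walk_length_rev u v p : walk u v p ->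
  walk_length l v (rev (belast u p)) = walk_length l u p.
Proof.
elim: p u => [|z p IH] u; first by rewrite !walk_length_nil.
rewrite /walk /= => /andP[/andP[uz zp] zv]; have z_v : walk z v p by rewrite /walk zp.
rewrite rev_cons -cats1 walk_length_cat (IH z z_v) !walk_length_cons walk_length_nil.
by have /andP[_ /eqP ->] := walk_rev z_v; rewrite addr0 addrC (l_sym uz).
Qed.

Lemma graph_dist_le u v p : walk u v p -> dist u v <= walk_length l u p.
Proof.
move=> uv; apply: ge_inf; last by exists p.
by exists 0 => _ [q /andP[uq _] ->]; exact: walk_length_ge0.
Qed.

Lemma le_graph_dist u v k : connected u v ->
  (forall p, walk u v p -> k <= walk_length l u p) -> k <= dist u v.
Proof.
case/connected_walkP => p uv k_le; apply: lb_le_inf; first by exists (walk_length l u p), p.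
by move=> _ [q uv_q ->]; exact: k_le.
Qed.

Lemma graph_dist_disconnected u v : ~~ connected u v -> dist u v = 0.
Proof.
move=> /connected_walkP no_walk; rewrite /graph_dist inf_out // => -[[x [p uv _]] _].
by apply: no_walk; exists p.
Qed.

Lemma graph_dist_ge0 u v : 0 <= dist u v.
Proof.
have [uv|/graph_dist_disconnected ->//] := boolP (connected u v).
by apply: le_graph_dist uv _ => p /andP[up _]; exact: walk_length_ge0.
Qed.

Lemma graph_distxx u : dist u u = 0.
Proof.
apply/le_anti; rewrite graph_dist_ge0 andbT -(walk_length_nil u) graph_dist_le //.
by rewrite /walk /= eqxx.
Qed.

Lemma graph_dist_sym u v : dist u v = dist v u.
Proof.
have le_sym x z : connected x z -> dist x z <= dist z x.
  rewrite connected_sym => zx; apply: le_graph_dist zx _ => p zx_p.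
  by rewrite -(walk_length_rev zx_p) graph_dist_le // walk_rev.
have [uv|uv] := boolP (connected u v).
  by apply/le_anti; rewrite !le_sym // connected_sym.
by rewrite !graph_dist_disconnected // connected_sym.
Qed.

Lemma graph_dist_triangle u v z :
  connected u v -> connected v z -> dist u z <= dist u v + dist v z.
Proof.
move=> uv vz; rewrite -lerBlDr; apply: le_graph_dist uv _ => p uv_p.
rewrite lerBlDr -lerBlDl; apply: le_graph_dist vz _ => q vz_q.
have /andP[_ /eqP lp] := uv_p; rewrite lerBlDl -[in leRHS]lp -walk_length_cat.
by apply: graph_dist_le; rewrite walk_cat lp uv_p.
Qed.

Lemma graph_dist_semimetric : semimetric_on connected dist.
Proof.
split; [exact: connect0|exact: connected_sym|exact: connect_trans|exact: graph_distxx|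
  exact: graph_dist_sym|exact: graph_dist_ge0|exact: graph_dist_triangle].
Qed.

Lemma graph_dist_adj u v : adj u v -> dist u v <= l u v.
Proof.
move=> uv; rewrite -[l u v]addr0 -(walk_length_nil v) -walk_length_cons.
by apply: graph_dist_le; rewrite /walk /= uv eqxx.
Qed.

Lemma shortest_path_cat u v p q : shortest_path l u v (p ++ q) ->
  [/\ shortest_path l u (last u p) p, shortest_path l (last u p) v q &
      dist u v = dist u (last u p) + dist (last u p) v].
Proof.
set x := last u p; case; rewrite walk_cat walk_length_cat -/x => /andP[ux xv] uv_dist.
have := graph_dist_le ux; have := graph_dist_le xv.
have : dist u v <= dist u x + dist x v.
  by apply: graph_dist_triangle; apply/connected_walkP; [exists p|exists q].
by move=> uv_le xv_le ux_le; split; [split=> //; lra|split=> //; lra|lra].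
Qed.

Lemma shortest_path_uniq u v p : shortest_path l u v p -> uniq (u :: p).
Proof.
elim: p u => [|z p IH] u // up.
have [_ /IH z_uniq _] := shortest_path_cat (p := [:: z]) up.
rewrite cons_uniq z_uniq andbT; apply/negP => u_in.
case/path.splitP: u_in up => p1 p2 /shortest_path_cat[[/andP[up1 _] +] _ _].
rewrite last_rcons graph_distxx => /eqP; rewrite gt_eqF // walk_length_gt0 //.
by case: p1 {up1}.
Qed.

End Distance.

(** * First hitting maps *)

Lemma iter_inj (T : Type) (f : T -> T) n : injective f -> injective (iter n f).
Proof. by move=> f_inj; elim: n => [|n IH] x y //= /f_inj /IH. Qed.

Section FirstHit.
Variables (T : finType) (psi : T -> T) (B : {set T}).
Hypothesis psi_inj : injective psi.
Hypothesis B_hit : forall d, exists n, iter n.+1 psi d \in B.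
Implicit Types (b c d : T) (n : nat).

Definition first_hit d := iter (ex_minn (B_hit d)).+1 psi d.

Lemma first_hitE d n : iter n.+1 psi d \in B ->
  (forall i, (0 < i <= n)%N -> iter i psi d \notin B) -> first_hit d = iter n.+1 psi d.
Proof.
move=> nB before; rewrite /first_hit; case: ex_minnP => m mB m_min; rewrite (_ : m = n) //.
apply/eqP; rewrite eqn_leq m_min //= leqNgt; apply/negP => mn.
by have := before m.+1 mn; rewrite mB.
Qed.

Lemma first_hit_in d : first_hit d \in B.
Proof. by rewrite /first_hit; case: ex_minnP. Qed.

Lemma first_hit_connect d : fconnect psi d (first_hit d).
Proof. exact: fconnect_iter. Qed.

Lemma first_hit_step d : first_hit d = if psi d \in B then psi d else first_hit (psi d).
Proof.
case: ifPn => dB; first by apply: (@first_hitE d 0) => // -[|i].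
rewrite [RHS]/first_hit; case: ex_minnP => m mB m_min.
rewrite -iterSr; apply: first_hitE; first by rewrite iterSr.
case=> [//|[_ //|i]] /= im; apply/negP; rewrite -iterS iterSr => iB.
by have := m_min _ iB; rewrite leqNgt -ltnS im.
Qed.

Lemma first_hit_inj : {in B &, injective first_hit}.
Proof.
have inj_le c d : c \in B -> first_hit c = first_hit d ->
    (ex_minn (B_hit c) <= ex_minn (B_hit d))%N -> c = d.
  rewrite /first_hit; case: ex_minnP => m mB _; case: ex_minnP => n nB n_min cB.
  move=> + mn; rewrite -(subnKC mn) -addSn iterD => /(iter_inj psi_inj).
  case nm: (n - m)%N => [|i] //= cE.
  by rewrite cE in cB; have := n_min i cB; lia.
move=> c d cB dB cd; have [le_cd|/ltnW le_dc] := leqP (ex_minn (B_hit c)) (ex_minn (B_hit d)).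
  exact: inj_le.
by apply/esym/inj_le.
Qed.

(* Off [B] the return map is the identity, which keeps it a permutation. *)
Definition return_map b := if b \in B then first_hit b else b.

Lemma return_map_inj : injective return_map.
Proof.
move=> c d; rewrite /return_map; case: ifPn => cB; case: ifPn => dB //.
- exact: first_hit_inj.
- by move=> cd; rewrite -cd first_hit_in in dB.
- by move=> cd; rewrite cd first_hit_in in cB.
Qed.

Lemma return_map_connect b : fconnect psi b (return_map b).
Proof. by rewrite /return_map; case: ifP => _; rewrite ?connect0 ?first_hit_connect. Qed.

Lemma first_hit_eq_return b d : d \in B ->
  (first_hit d == return_map b) = (b == d) && (b \in B).
Proof.
move=> dB; rewrite /return_map; case: ifPn => bB; rewrite ?andbT ?andbF.
  by rewrite eq_sym; apply/eqP/eqP => [/first_hit_inj ->|->].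
by apply: contraNF bB => /eqP <-; exact: first_hit_in.
Qed.

Lemma first_hit_telescope (h : pred T) b :
  \big[addb/false]_(d | first_hit d == return_map b) (h d (+) h (psi d)) =
  h b (+) h (return_map b).
Proof.
set c := return_map b; rewrite big_split /=.
have -> : \big[addb/false]_(d | first_hit d == c) h (psi d) =
    \big[addb/false]_(d | (if d \in B then d else first_hit d) == c) h d.
  rewrite [RHS](reindex_inj psi_inj) /=; apply: eq_bigl => d.
  by rewrite first_hit_step.
transitivity (\big[addb/false]_(d | h d && (d \in B)) ((b == d) && (b \in B) (+) (c == d))).
  rewrite [X in X (+) _]big_mkcond [X in _ (+) X]big_mkcond [RHS]big_mkcond -big_split.
  apply: eq_bigr => d _ /=; rewrite (eq_sym c).
  case dB: (d \in B); rewrite ?andbT ?andbF; last by rewrite addbb.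
  rewrite -first_hit_eq_return // -/c.
  by case: (h d); do 2 case: (_ == c).
rewrite big_split /= big_addb_eq /c /return_map; case: ifP => bB.
  under eq_bigr do rewrite andbT.
  by rewrite big_addb_eq bB first_hit_in !andbT.
by rewrite big1 => [|d _]; rewrite ?bB ?andbF // !addbb.
Qed.

End FirstHit.

Lemma orbit_telescope (T : finType) (p : T -> T) (h g : pred T) : injective p ->
  (forall x, g (p x) = g x) -> \big[addb/false]_(x | g x) (h x (+) h (p x)) = false.
Proof.
move=> p_inj gp; rewrite big_split /= (reindex_inj p_inj) /=.
by under eq_bigl do rewrite gp; rewrite addbb.
Qed.

(** * Cuts and bonds of a planar graph *)

Section Cuts.
Variable G : sgraph.
Implicit Types (S : {set G}) (C : {set dart G}) (d : dart G) (u v : G) (p : seq G).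

Definition dart_of u v (uv : adj u v) : dart G := exist _ (u, v) uv.

Lemma dart_eq d d' : dart_src d = dart_src d' -> dart_tgt d = dart_tgt d' -> d = d'.
Proof.
move=> src_eq tgt_eq; apply/val_inj.
by rewrite [LHS]surjective_pairing [RHS]surjective_pairing; congr pair.
Qed.

Lemma dart_revK : involutive (@dart_rev G).
Proof. by move=> d; exact: dart_eq. Qed.

Lemma dart_rev_inj : injective (@dart_rev G).
Proof. exact: can_inj dart_revK. Qed.

Lemma dart_rev_neq d : dart_rev d != d.
Proof.
apply/eqP => dd; have ts : dart_tgt d = dart_src d by rewrite -[in RHS]dd.
by have := valP d; rewrite /= -/(dart_src d) -/(dart_tgt d) ts adj_irrefl.
Qed.

Definition cut S : {set dart G} := edge_cut (@dart_src G) (@dart_tgt G) S.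
Definition is_cut C := [exists S, C == cut S].
Definition bond S := minimal_nonempty is_cut (cut S).

Lemma in_cut S d : (d \in cut S) = sep S (dart_src d) (dart_tgt d).
Proof. by rewrite inE. Qed.

Lemma cut_rev S d : (dart_rev d \in cut S) = (d \in cut S).
Proof. by rewrite !in_cut sep_sym. Qed.

Lemma cut_symdiff S S' : cut (symdiff S S') = symdiff (cut S) (cut S').
Proof. by apply/setP => d; rewrite in_symdiff !in_cut sep_symdiff. Qed.

Lemma is_cutP C : reflect (exists S, C = cut S) (is_cut C).
Proof. exact: (iffP exists_eqP). Qed.

Lemma is_cut_symdiff C C' : is_cut C -> is_cut C' -> is_cut (symdiff C C').
Proof.
move=> /is_cutP[S ->] /is_cutP[S' ->]; apply/is_cutP.
by exists (symdiff S S'); rewrite cut_symdiff.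
Qed.

Lemma walk_sep S u v p : walk u v p -> sep S u v ->
  exists2 d, d \in cut S & (dart_src d, dart_tgt d) \in walk_edges u p.
Proof.
elim: p u => [|z p IH] u; rewrite /walk /=; first by move=> /eqP ->; rewrite sepxx.
move=> /andP[/andP[uz zp] zv]; rewrite (sep_addb z).
have [S_uz _|_ /= S_zv] := boolP (sep S u z).
  by exists (dart_of uz); rewrite ?in_cut // walk_edges_cons mem_head.
have [|d dS dp] := IH z _ S_zv; first by rewrite /walk zp.
by exists d => //; rewrite walk_edges_cons in_cons dp orbT.
Qed.

Lemma cut_eq0_sep S u v : cut S = set0 -> connect (@adj G) u v -> sep S u v = false.
Proof.
move=> S0 /connected_walkP[p uv_p]; apply/negbTE/negP => /(walk_sep uv_p)[d].
by rewrite S0 inE.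
Qed.

Lemma bond_ind (P : {set G} -> Prop) :
    (forall S, cut S = set0 -> P S) ->
    (forall S S1, bond S1 -> cut S1 \subset cut S -> P (symdiff S S1) -> P S) ->
  forall S, P S.
Proof.
move=> P0 PI S.
suff /(_ (cut S)) : forall C, is_cut C -> forall S', cut S' = C -> P S'.
  by apply=> //; apply/is_cutP; exists S.
apply: symdiff_closed_ind => [||A C A_bond _ AC IH S' S'E].
- exact: is_cut_symdiff.
- exact: P0.
have [/is_cutP[S1 AE] _ _] := minimal_nonemptyP A_bond; rewrite AE in A_bond AC S'E.
apply: (PI S' S1 A_bond); first by rewrite S'E subsetUl.
apply: IH; rewrite cut_symdiff S'E symdiff_subset ?subsetUl //.
by rewrite setDUl setDv set0U; apply/setDidPl; rewrite disjoint_sym.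
Qed.

Lemma bond_separating u v :
  connect (@adj G) u v -> u != v -> exists2 S, bond S & sep S u v.
Proof.
move=> uv u_v; have : sep [set u] u v by rewrite /sep !inE eqxx eq_sym (negPf u_v).
move: [set u]; apply: bond_ind => [S S0|S S1 S1_bond _ IH].
  by rewrite cut_eq0_sep.
case S1_uv: (sep S1 u v) => S_uv; first by exists S1.
by apply: IH; rewrite sep_symdiff S_uv S1_uv.
Qed.

Lemma cut_orbit_even (psi : dart G -> dart G) S d0 : injective psi ->
    (forall d, dart_src (psi d) = dart_tgt d) ->
  \big[addb/false]_(d in cut S) (froot psi d == d0) = false.
Proof.
move=> psi_inj psi_src.
apply: etrans (orbit_telescope (g := fun d => froot psi d == d0)
  (fun d => dart_src d \in S) psi_inj _); last by move=> d; rewrite froot_succ.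
rewrite big_mkcond [RHS]big_mkcond; apply: eq_bigr => d _; rewrite in_cut /sep psi_src.
by do 2 case: ifP.
Qed.

End Cuts.

Section Planar.
Variables (G : sgraph) (M : planar_embedding G).
Local Notation phi := (next_on_face (rot M)).
Implicit Types (S : {set G}) (C : {set dart G}) (d : dart G).

Lemma next_on_face_inj : injective phi.
Proof. by move=> d d' /(@rot_inj _ M)/(@dart_rev_inj G). Qed.

Lemma rot_src d : dart_src (rot M d) = dart_src d.
Proof. by apply/esym/eqP; rewrite -(rot_orbit M) fconnect1. Qed.

Lemma next_on_face_src d : dart_src (phi d) = dart_tgt d.
Proof. exact: rot_src. Qed.

Lemma face_even_cut C : (forall d, (dart_rev d \in C) = (d \in C)) ->
    (forall d0, \big[addb/false]_(d in C) (froot phi d == d0) = false) ->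
  exists S, C = cut S.
Proof.
move=> C_rev C_face; have [h h_rot hC] := face_even_coboundary (@rot_inj _ M)
  (@dart_revK G) (@dart_rev_neq G) (rot_planar M) C_rev C_face.
have h_src d d' : dart_src d = dart_src d' -> h d = h d'.
  move/eqP; rewrite -(rot_orbit M) => /iter_findex <-.
  by elim: (findex _ _ _) => //= n ->; rewrite h_rot.
pose S := [set u | [exists d, (dart_src d == u) && h d]].
have in_S d : (dart_src d \in S) = h d.
  rewrite inE; apply/existsP/idP => [[d' /andP[/eqP/h_src <- //]]|hd].
  by exists d; rewrite eqxx.
exists S; apply/setP => d.
by rewrite hC in_cut /sep in_S -[dart_tgt d]/(dart_src (dart_rev d)) in_S.
Qed.

(* The dual multigraph, with every edge subdivided: its vertices are the faces
   and the edges of the map, its edges are the darts. *)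
Definition dual_src d : dart G + dart G := inl (froot phi d).
Definition dual_tgt d : dart G + dart G := inr (froot (@dart_rev G) d).

Lemma dart_rev_froot_eq d d' :
  (froot (@dart_rev G) d' == froot (@dart_rev G) d) = (d' == d) || (d' == dart_rev d).
Proof.
rewrite froot_connect; last exact: dart_rev_inj.
rewrite fconnect_sym ?(involution_connect _ _ (@dart_revK G)) ?inE //.
exact: dart_rev_inj.
Qed.

Lemma dart_rev_parity C d :
  \big[addb/false]_(d' in C) (froot (@dart_rev G) d' == froot (@dart_rev G) d) =
  (d \in C) (+) (dart_rev d \in C).
Proof.
transitivity (\big[addb/false]_(d' in C) ((d == d') (+) (dart_rev d == d'))).
  apply: eq_bigr => d' _; rewrite dart_rev_froot_eq !(eq_sym d').
  by case: eqP => // <-; rewrite (negPf (dart_rev_neq d)).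
by rewrite big_split /= !big_addb_eq.
Qed.

Lemma dual_even_set C : even_set dual_src dual_tgt C = is_cut C.
Proof.
apply/even_setP/is_cutP => [C_even|[S ->] [d0|d0]]; rewrite /odd_degree /odd_end /=.
- apply: face_even_cut => [d|d0].
    have := C_even (inr (froot (@dart_rev G) d)); rewrite /odd_degree /odd_end /= dart_rev_parity.
    by do 2 case: (_ \in C).
  have := C_even (inl d0); rewrite /odd_degree /odd_end /=.
  by under eq_bigr do rewrite addbF.
- under eq_bigr do rewrite addbF.
  exact: cut_orbit_even next_on_face_inj next_on_face_src.
exact: (@cut_orbit_even _ (@dart_rev G) _ _ (@dart_rev_inj G)).
Qed.

Lemma bond_face S d1 : bond S -> d1 \in cut S ->
  exists2 d2, d2 != d1 & [set d in cut S | froot phi d == froot phi d1] = [set d1; d2].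
Proof.
move=> S_bond d1S; have starE d0 :
    star dual_src dual_tgt (cut S) (inl d0) = [set d in cut S | froot phi d == d0].
  by apply/setP => d; rewrite !inE /odd_end /= addbF.
have S_circuit : circuit dual_src dual_tgt (cut S).
  by rewrite /circuit (minimal_nonempty_eq dual_even_set).
by rewrite -starE; apply: circuit_star S_circuit _; rewrite starE inE d1S eqxx.
Qed.

End Planar.

(** * Cut metrics and cut packings *)

Section CutMetric.
Variables (R : numDomainType) (V : finType).
Implicit Types (y : {set V} -> R) (S : {set V}) (u v x : V).

Definition cut_metric y u v : R := \sum_S y S * (sep S u v)%:R.

Lemma cut_metricxx y u : cut_metric y u u = 0.
Proof. by rewrite /cut_metric big1 // => S _; rewrite sepxx mulr0. Qed.

Lemma cut_metric_sym y u v : cut_metric y u v = cut_metric y v u.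
Proof. by apply: eq_bigr => S _; rewrite sep_sym. Qed.

Lemma cut_metric_lincomb (I : finType) (k : I -> R) (z : I -> {set V} -> R) u v :
  cut_metric (fun S => \sum_i k i * z i S) u v = \sum_i k i * cut_metric (z i) u v.
Proof.
rewrite /cut_metric; under eq_bigr do rewrite mulr_suml.
rewrite exchange_big; apply: eq_bigr => i _ /=; rewrite mulr_sumr.
by apply: eq_bigr => S _; rewrite mulrA.
Qed.

Variable y : {set V} -> R.
Hypothesis y_ge0 : forall S, 0 <= y S.

Lemma cut_metric_ge0 u v : 0 <= cut_metric y u v.
Proof. by apply: sumr_ge0 => S _; rewrite mulr_ge0. Qed.

Lemma cut_metric_triangle u v x : cut_metric y u x <= cut_metric y u v + cut_metric y v x.
Proof.
rewrite /cut_metric -big_split; apply: ler_sum => S _ /=; rewrite -mulrDr ler_wpM2l //.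
by rewrite (sep_addb v) -natrD ler_nat; do 2 case: (sep S _ _).
Qed.

End CutMetric.

Section JoinLength.
Variables (R : numDomainType) (V E : finType) (s t : E -> V).
Variables (d : V -> V -> R) (conn : rel V).
Hypothesis d_semimetric : semimetric_on conn d.
Hypothesis conn_edge : forall e, conn (s e) (t e).
Local Notation edge_dist := (fun e => d (s e) (t e)).

Lemma join_length J x y : is_join s t x y J -> conn x y /\ d x y <= wt edge_dist J.
Proof.
have [n] := ubnP #|J|; elim: n J x => // n IH J x leJ Jxy.
have [->|xy] := eqVneq x y.
  rewrite (semimetricxx d_semimetric); split; first exact: (conn_refl d_semimetric).
  by apply: sumr_ge0 => e _; exact: (semimetric_ge0 d_semimetric).
have [e] : exists e, e \in star s t J x.
  by apply: odd_degree_star; rewrite (is_joinP _ _ _ _ _ Jxy) eqxx (negPf xy).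
rewrite inE => /andP[eJ ex].
have [z [xz_join xz xz_d]] : exists z, [/\ is_join s t x z [set e], conn x z & d x z = edge_dist e].
  have e_join := is_join_edge s t e.
  move: ex; rewrite /odd_end; have [<- _|_ /eqP <-] := eqVneq (s e) x; first by exists (t e).
  exists (s e); rewrite is_join_sym (conn_sym d_semimetric).
  by rewrite (semimetric_sym d_semimetric (t e)).
have Jzy : is_join s t z y (J :\ e).
  by rewrite is_join_sym; apply: is_joinD xz_join; rewrite ?sub1set // is_join_sym.
have [|zy zy_le] := IH _ _ _ Jzy; first by rewrite (cardsD1 e) eJ in leJ.
split; first exact: (conn_trans d_semimetric) xz zy.
apply: le_trans (semimetric_triangle d_semimetric xz zy) _.
by rewrite /wt (big_setD1 e) //= xz_d lerD2l.
Qed.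

End JoinLength.

Section AbstractDual.
Variables (V W E : finType).
Implicit Types (s t : E -> V) (sd td : E -> W).

Definition abstract_dual s t sd td :=
  (forall C, even_set sd td C -> exists S, C = edge_cut s t S) /\
  (forall X, even_set s t (edge_cut sd td X)).

Lemma edge_cut_even s t sd td :
  (forall x, even_set s t (edge_cut sd td [set x])) ->
  forall X, even_set s t (edge_cut sd td X).
Proof.
move=> even1 X; have [n] := ubnP #|X|; elim: n X => // n IH X leX.
have [->|/set0Pn[x xX]] := eqVneq X set0.
  rewrite (_ : edge_cut _ _ _ = set0) ?even_set0 //.
  by apply/setP => e; rewrite inE /sep !inE.
rewrite (_ : edge_cut sd td X =
  symdiff (edge_cut sd td [set x]) (edge_cut sd td (X :\ x))).
  by apply: even_set_symdiff (even1 x) (IH _ _); rewrite (cardsD1 x) xX in leX.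
apply/setP => e; rewrite in_symdiff 3!inE -sep_symdiff; congr sep.
by apply/setP => z; rewrite !inE; case: eqP => // ->; rewrite xX.
Qed.

End AbstractDual.

Section CutPacking.
Variables (R : realFieldType) (V W E : finType) (s t : E -> V) (sd td : E -> W).
Variables (d : V -> V -> R) (conn : rel V).
Hypothesis st_dual : abstract_dual s t sd td.
Hypothesis d_semimetric : semimetric_on conn d.
Hypothesis conn_edge : forall e, conn (s e) (t e).
Local Notation edge_dist := (fun e => d (s e) (t e)).

Lemma dual_cut_dominated : cut_dominated sd td edge_dist.
Proof.
have [_ cut_even] := st_dual; move=> X e eX.
have De_join : is_join s t (s e) (t e) (edge_cut sd td X :\ e).
  apply: is_joinD (is_join_edge s t e); rewrite ?sub1set //.
  by rewrite is_joinxx cut_even.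
by have [] := join_length d_semimetric conn_edge De_join.
Qed.

Theorem dual_cut_packing : exists2 y : {set V} -> R,
  forall S, 0 <= y S & forall e, d (s e) (t e) = cut_metric y (s e) (t e).
Proof.
have [even_cut _] := st_dual.
have [z z_ge0 dE] := sums_of_circuits
  (fun e => semimetric_ge0 d_semimetric (s e) (t e)) dual_cut_dominated.
have [side sideE] := choice (fun C : {C : {set E} | even_set sd td C} => even_cut _ (valP C)).
exists (fun S => \sum_C z C * (S == side C)%:R) => [S|e].
  by apply: sumr_ge0 => C _; rewrite mulr_ge0.
rewrite dE cut_metric_lincomb; apply: eq_bigr => C _; congr (_ * _).
rewrite /cut_metric (bigD1 (side C)) //= eqxx mul1r big1 ?addr0.
  by rewrite {1}sideE inE.
by move=> S /negPf ->; rewrite mul0r.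
Qed.

End CutPacking.

Section BondPacking.
Variables (R : realType) (G : sgraph) (l : G -> G -> R).
Hypothesis l_pos : forall u v : G, adj u v -> 0 < l u v.
Implicit Types (S : {set G}) (u v : G) (y : {set G} -> R).

Definition bond_packing y := [/\ forall S, 0 <= y S, forall S, ~~ bond S -> y S = 0 &
  forall u v, adj u v -> cut_metric y u v <= graph_dist l u v].

Lemma bond_packing_le_dist y u v : bond_packing y -> connect (@adj G) u v ->
  cut_metric y u v <= graph_dist l u v.
Proof.
case=> y_ge0 _ y_adj uv; apply: le_graph_dist uv _ => p.
elim: p u => [|z p IH] u; rewrite /walk /=.
  by move=> /eqP ->; rewrite cut_metricxx walk_length_nil.
move=> /andP[/andP[uz zp] zv]; rewrite walk_length_cons.
apply: le_trans (cut_metric_triangle y_ge0 u z v) _; rewrite lerD ?IH ?/walk ?zp //.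
exact: le_trans (y_adj _ _ uz) (graph_dist_adj l_pos uz).
Qed.

Lemma bond_packing_mean n (y : 'I_n.+1 -> {set G} -> R) : (forall i, bond_packing (y i)) ->
  bond_packing (fun S => \sum_i n.+1%:R^-1 * y i S).
Proof.
move=> y_pack; have n_ge0 : 0 <= n.+1%:R^-1 :> R by rewrite invr_ge0 ler0n.
split=> [S|S S_nbond|u v uv].
- by apply: sumr_ge0 => i _; rewrite mulr_ge0 //; case: (y_pack i).
- by rewrite big1 // => i _; case: (y_pack i) => _ -> //; rewrite mulr0.
rewrite cut_metric_lincomb -mulr_sumr mulrC ler_pdivrMr ?ltr0n // mulr_natr.
rewrite -[n.+1 in leRHS]card_ord -sumr_const.
by apply: ler_sum => i _; case: (y_pack i) => _ _; apply.
Qed.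

Lemma sep_bond_refinement S : exists z : {set G} -> R,
  [/\ forall S1, 0 <= z S1, forall S1, ~~ bond S1 -> z S1 = 0,
      forall u v, adj u v -> cut_metric z u v = (sep S u v)%:R &
      forall u v, connect (@adj G) u v -> (sep S u v)%:R <= cut_metric z u v].
Proof.
elim/bond_ind: S => [S S0|S S1 S1_bond S1_sub [z [z_ge0 z_bond z_adj z_conn]]].
  exists (fun=> 0); rewrite /cut_metric.
  by split=> // u v uv; rewrite big1 => [|S' _]; rewrite ?mul0r ?cut_eq0_sep // connect1.
have S1_z u v : cut_metric (fun S' => z S' + (S' == S1)%:R) u v =
    cut_metric z u v + (sep S1 u v)%:R.
  rewrite /cut_metric; under eq_bigr do rewrite mulrDl.
  rewrite big_split /=; congr (_ + _).
  rewrite (bigD1 S1) //= eqxx mul1r big1 ?addr0 // => S' /negPf ->; exact: mul0r.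
exists (fun S' => z S' + (S' == S1)%:R); split=> [S'|S' S'_nbond|u v uv|u v uv].
- by rewrite addr_ge0.
- by rewrite z_bond // add0r; case: eqP S'_nbond => // ->; rewrite S1_bond.
- rewrite S1_z z_adj // -natrD sep_symdiff.
  have := subsetP S1_sub (dart_of uv); rewrite !in_cut -!/(sep _ u v).
  by case: (sep S1 u v) => [/(_ isT) ->|]; rewrite ?addn0 ?addbF.
rewrite S1_z; apply: le_trans (lerD (z_conn _ _ uv) (lexx _)).
by rewrite sep_symdiff -natrD ler_nat; do 2 case: (sep _ u v).
Qed.

Lemma bond_refinement y : (forall S, 0 <= y S) -> exists z : {set G} -> R,
  [/\ forall S, 0 <= z S, forall S, ~~ bond S -> z S = 0,
      forall u v, adj u v -> cut_metric z u v = cut_metric y u v &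
      forall u v, connect (@adj G) u v -> cut_metric y u v <= cut_metric z u v].
Proof.
move=> y_ge0; have [z zP] := choice sep_bond_refinement.
exists (fun S => \sum_S' y S' * z S' S); split=> [S|S S_nbond|u v uv|u v uv].
- by apply: sumr_ge0 => S' _; rewrite mulr_ge0 //; case: (zP S').
- by rewrite big1 // => S' _; case: (zP S') => _ -> //; rewrite mulr0.
- by rewrite cut_metric_lincomb; apply: eq_bigr => S' _; case: (zP S') => _ _ -> //.
rewrite cut_metric_lincomb; apply: ler_sum => S' _; rewrite ler_wpM2l //.
by case: (zP S') => _ _ _; apply.
Qed.

End BondPacking.

(** * Chords inside the faces *)

(* [psi] rearranges the walks around the faces of [M], without leaving a face. *)
Definition face_walks (G : sgraph) (M : planar_embedding G) (psi : dart G -> dart G) :=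
  [/\ injective psi, forall d, dart_src (psi d) = dart_tgt d &
      forall d, fconnect (next_on_face (rot M)) d (psi d)].

Section FaceWalks.
Variables (G : sgraph) (M : planar_embedding G) (psi : dart G -> dart G).
Hypothesis psi_walks : face_walks M psi.
Local Notation phi := (next_on_face (rot M)).
Implicit Types (d b : dart G).

Lemma face_walks_inj : injective psi.
Proof. by case: psi_walks. Qed.

Lemma face_walks_src d : dart_src (psi d) = dart_tgt d.
Proof. by case: psi_walks. Qed.

Lemma face_walks_connected d d' :
  fconnect psi d d' -> connect (@adj G) (dart_src d) (dart_src d').
Proof.
move=> /iter_findex <-; elim: (findex _ _ _) => [|n IH] /=; first exact: connect0.
by apply: connect_trans IH _; rewrite face_walks_src connect1 ?(valP (iter n psi d)).
Qed.

Lemma face_walks_froot d d' : fconnect psi d d' -> froot phi d = froot phi d'.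
Proof.
move=> /iter_findex <-; elim: (findex _ _ _) => //= n ->.
apply/eqP; rewrite froot_connect; last exact: next_on_face_inj.
by case: psi_walks => _ _; apply.
Qed.

(* Inside every closed walk of [psi], draw a chord from each corner of [B] to
   the next one. [chord_src] and [chord_tgt] are the ends of the edges of the
   resulting planar graph. Its dual has one vertex [inl b] for each cell, cut
   off by the chord that ends in the corner [b], one vertex for each edge of [G],
   as in [dual_tgt], and one for what the chords leave of each closed walk. *)
Variable B : {set dart G}.
Hypothesis B_hit : forall d, exists n, iter n.+1 psi d \in B.
Local Notation hit := (first_hit B_hit).
Local Notation next := (return_map B_hit).
Let next_inj : injective next := return_map_inj face_walks_inj (B_hit := B_hit).

Definition chord_src (e : dart G + dart G) : G :=
  match e with inl d => dart_src d | inr b => dart_src b end.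
Definition chord_tgt (e : dart G + dart G) : G :=
  match e with inl d => dart_tgt d | inr b => dart_src (next b) end.
Definition cell_src (e : dart G + dart G) : dart G + (dart G + dart G) :=
  match e with inl d => inl (hit d) | inr b => inl (next b) end.
Definition cell_tgt (e : dart G + dart G) : dart G + (dart G + dart G) :=
  match e with
  | inl d => inr (inl (froot (@dart_rev G) d))
  | inr b => inr (inr (froot psi b))
  end.

Lemma chord_connected e : connect (@adj G) (chord_src e) (chord_tgt e).
Proof.
case: e => [d|b] /=; first exact: connect1 (valP d).
by apply: face_walks_connected; exact: return_map_connect.
Qed.

Lemma cell_even_set_cut C : even_set cell_src cell_tgt C ->
  exists S, C = edge_cut chord_src chord_tgt S.
Proof.
move=> C_even; pose C0 := [set d | inl d \in C].
have crossing (X : pred (dart G + (dart G + dart G))) :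
    \big[addb/false]_(d in C0) (X (inl (hit d)) (+) X (inr (inl (froot (@dart_rev G) d)))) =
    \big[addb/false]_(b | inr b \in C) (X (inl (next b)) (+) X (inr (inr (froot psi b)))).
  have /negbT := even_set_crossing X C_even; rewrite big_sumType /= negb_add.
  by move=> /eqP <-; apply: eq_bigl => d; rewrite inE.
have [S C0E] : exists S, C0 = cut S.
  apply: (@face_even_cut _ M) => [d|d0].
    have := crossing (fun w => if w is inr (inl e) then e == froot (@dart_rev G) d else false).
    by rewrite /= dart_rev_parity [RHS]big1 //; do 2 case: (_ \in C0).
  have := crossing (fun w => match w with
    inl e | inr (inr e) => froot phi e == d0 | _ => false end).
  rewrite /= [RHS]big1 => [faces_even|b _].
    rewrite -[RHS]faces_even; apply: eq_bigr => d _.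
    by rewrite addbF (face_walks_froot (first_hit_connect B_hit d)).
  rewrite -(face_walks_froot (return_map_connect B_hit b)).
  by rewrite -(face_walks_froot (connect_root _ b)) addbb.
exists S; apply/setP => -[d|b]; first by have /setP/(_ d) := C0E; rewrite !inE.
have := crossing (fun w => if w is inl c then c == next b else false).
under eq_bigr do rewrite /= addbF.
under [RHS]eq_bigr do rewrite /= addbF (inj_eq next_inj) eq_sym.
rewrite big_addb_eq => <-.
rewrite inE /sep /= -(first_hit_telescope face_walks_inj B_hit [pred d | dart_src d \in S]).
rewrite big_mkcond [RHS]big_mkcond; apply: eq_bigr => d _.
by rewrite C0E in_cut /sep /= face_walks_src; do 2 case: ifP.
Qed.

Lemma cell_star_even w : even_set chord_src chord_tgt (edge_cut cell_src cell_tgt [set w]).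
Proof.
apply/even_setP => x; rewrite /odd_degree big_sumType /odd_end /=.
pose at_x d := dart_src d == x.
have telescope (p : dart G -> dart G) (g : pred (dart G)) : injective p ->
    (forall d, g (p d) = g d) ->
    \big[addb/false]_(d | g d) ((dart_src d == x) (+) (dart_src (p d) == x)) = false.
  exact: (orbit_telescope at_x).
case: w => [c|[e|o]].
- have [b bE] : exists b, next b = c.
    by exists (invF next_inj c); rewrite f_invF.
  rewrite -bE; transitivity ((at_x b (+) at_x (next b)) (+) (at_x b (+) at_x (next b))).
    congr (_ (+) _).
      rewrite -(first_hit_telescope face_walks_inj B_hit at_x).
      by apply: eq_big => [d|d _]; rewrite /at_x ?face_walks_src // inE /sep !inE addbF.
    rewrite (big_pred1 b) // => b'; rewrite inE /sep !inE addbF.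
    exact: inj_eq.
  exact: addbb.
- rewrite [X in _ (+) X]big_pred0 ?addbF => [|b]; last by rewrite inE /sep !inE.
  apply: etrans (telescope (@dart_rev G) [pred d | froot (@dart_rev G) d == e] _ _).
  + by apply: eq_bigl => d; rewrite !inE /sep !inE.
  + exact: dart_rev_inj.
  + by move=> d; rewrite /= froot_succ //; exact: dart_rev_inj.
rewrite big_pred0 => [|d]; last by rewrite inE /sep !inE.
apply: etrans (telescope next [pred b | froot psi b == o] _ _).
- by apply: eq_bigl => b; rewrite !inE /sep !inE.
- exact: next_inj.
- move=> b; congr (_ == _); apply/esym/eqP.
  by rewrite froot_connect ?return_map_connect //; exact: face_walks_inj.
Qed.

Lemma chord_cell_dual : abstract_dual chord_src chord_tgt cell_src cell_tgt.
Proof. by split; [exact: cell_even_set_cut|exact: edge_cut_even cell_star_even]. Qed.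

Variables (R : realType) (l : G -> G -> R).
Hypothesis l_sym : forall u v : G, adj u v -> l u v = l v u.
Hypothesis l_pos : forall u v : G, adj u v -> 0 < l u v.

Theorem chord_packing : exists2 y, bond_packing l y &
  forall b, graph_dist l (dart_src b) (dart_src (next b)) <=
    cut_metric y (dart_src b) (dart_src (next b)).
Proof.
have [z z_ge0 zE] := dual_cut_packing chord_cell_dual (graph_dist_semimetric l_sym l_pos)
  chord_connected.
have [y [y_ge0 y_bond y_adj y_conn]] := bond_refinement z_ge0.
exists y => [|b]; first split=> // u v uv.
  by rewrite y_adj // (zE (inl (dart_of uv))).
rewrite (zE (inr b)) y_conn //; exact: (chord_connected (inr b)).
Qed.

End FaceWalks.

(** * Arc systems on a line *)

(* The arc from [i] to [j] has sides [p <= q] around [a]. The triangle inequality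
   through [a] leaves [q - p] to [rho']; [rho] keeps [p + q] unless [v] comes
   before [j], and then at least [3 * p - q]. *)
Lemma shorter_side_half (R : realFieldType) (T : Type) (rho rho' : T -> T -> R)
    (i a j v : T) (p q q' : R) :
    (forall x y z, rho x z <= rho x y + rho y z) ->
    (forall x y z, rho' x z <= rho' x y + rho' y z) ->
    0 <= rho i j -> p <= q -> p <= q' -> rho' a i <= p -> q <= rho' a j ->
    p + q' <= rho i v -> rho j v <= `|q' - q| ->
  (p + q) / 2 <= rho i j + rho' i j.
Proof.
move=> /(_ i j v) rho_ijv /(_ a i j) rho'_aij rho_ge0 pq pq' ai aj iv jv.
by case: ler0P jv => q'q jv; lra.
Qed.

Section ArcSystem.
Variable m : nat.
Implicit Types (A : nat -> nat * nat) (i k n : nat).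

Definition arc_system A :=
  (forall k, (A k).1 <= (A k).2 <= (A k.+1).1)%N /\
  forall k, ((A k).2 <= (A 0%N).1 + m)%N.

Definition endpoint A i := exists k, i = (A k).1 \/ i = (A k).2.

Lemma arc_system_homo A k n : arc_system A -> (k <= n)%N -> ((A k).1 <= (A n).1)%N.
Proof.
case=> A_le _; elim: n => [|n IH]; first by rewrite leqn0 => /eqP ->.
rewrite leq_eqVlt => /predU1P[->//|/IH kn].
by have /andP[] := A_le n; lia.
Qed.

Lemma arc_system_window A i : arc_system A -> endpoint A i ->
  ((A 0%N).1 <= i <= (A 0%N).1 + m)%N.
Proof.
move=> A_arcs [k i_k]; have [/(_ k)/andP[k_le _] /(_ k) k_window] := A_arcs.
by have := arc_system_homo A_arcs (leq0n k); case: i_k => ->; lia.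
Qed.

Lemma arc_system_gap A k i : arc_system A -> endpoint A i ->
  (i <= (A k).1)%N \/ ((A k).2 <= i)%N.
Proof.
move=> A_arcs [n i_n]; have [A_le _] := A_arcs.
have [/andP[k1 k2] /andP[n1 n2]] := (A_le k, A_le n).
case: (ltngtP n k) => [/(arc_system_homo A_arcs) nk|/(arc_system_homo A_arcs) kn|nk].
- by left; case: i_n => ->; lia.
- by right; case: i_n => ->; lia.
by rewrite nk in i_n; case: i_n => ->; [left|right].
Qed.

End ArcSystem.

Section Line.
Variables (R : realFieldType) (D : nat -> nat -> R) (L : nat -> R) (m : nat).
Hypothesis m_gt0 : (0 < m)%N.
Hypothesis L_gt0 : forall k, 0 < L k.
Hypothesis Dxx : forall i, D i i = 0.
Hypothesis D_triangle : forall i j k, D i k <= D i j + D j k.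
(* The line is the universal cover of a closed walk with [m] corners. *)
Hypothesis D_period : forall i, D i (i + m)%N = 0.
Implicit Types (i j k u v a lo hi : nat) (p : nat * nat) (rho : nat -> nat -> R).

Definition len i j := \sum_(i <= k < j) L k.
Hypothesis D_le_len : forall i j, (i <= j)%N -> D i j <= len i j.

Lemma len_cat j i k : (i <= j)%N -> (j <= k)%N -> len i k = len i j + len j k.
Proof. by move=> ij jk; rewrite /len (big_cat_nat ij jk). Qed.

Lemma len_ge0 i j : 0 <= len i j.
Proof. by apply: sumr_ge0 => k _; exact: ltW. Qed.

Lemma len_gt0 i j : (i < j)%N -> 0 < len i j.
Proof.
move=> ij; rewrite (len_cat (leqnSn i) ij) {1}/len big_nat1.
by rewrite ltr_pwDl ?len_ge0.
Qed.

Definition geodesic i j := (i <= j)%N && (D i j == len i j).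

Lemma geodesic_le i j : geodesic i j -> (i <= j)%N.
Proof. by case/andP. Qed.

Lemma geodesicE i j : geodesic i j -> D i j = len i j.
Proof. by case/andP => _ /eqP. Qed.

Lemma geodesicxx i : geodesic i i.
Proof. by rewrite /geodesic leqnn Dxx /len big_geq ?eqxx. Qed.

Lemma geodesic_sub i j u v : geodesic i j ->
  (i <= u)%N -> (u <= v)%N -> (v <= j)%N -> geodesic u v.
Proof.
move=> /geodesicE ij iu uv vj; rewrite /geodesic uv eq_le D_le_len //=.
have := D_triangle i u j; have := D_triangle u v j.
have := D_le_len iu; have := D_le_len vj.
by move: ij; rewrite (len_cat (leq_trans iu uv) vj) (len_cat iu uv); lra.
Qed.

Lemma geodesic_period i j : geodesic i j -> (j <= i + m)%N.
Proof.
move=> ij; rewrite leqNgt; apply/negP => /ltnW im_j.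
have /geodesicE := geodesic_sub ij (leqnn i) (leq_addr m i) im_j.
by move/eqP; rewrite D_period lt_eqF // len_gt0 // -[ltnLHS]addn0 ltn_add2l.
Qed.

Lemma geodesic_leftmost a : exists2 u, geodesic u a & forall i, geodesic i a -> (u <= i)%N.
Proof.
have ex_geo : exists u, geodesic u a by exists a; exact: geodesicxx.
by exists (ex_minn ex_geo); case: ex_minnP.
Qed.

Lemma geodesic_exists a : exists j, geodesic a j.
Proof. by exists a; exact: geodesicxx. Qed.

Definition farthest a := ex_maxn (geodesic_exists a) (@geodesic_period a).

Lemma geodesic_farthest a : geodesic a (farthest a).
Proof. by rewrite /farthest; case: ex_maxnP. Qed.

Lemma farthest_max a j : geodesic a j -> (j <= farthest a)%N.
Proof. by rewrite /farthest; case: ex_maxnP => v _ v_max; exact: v_max. Qed.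

(** ** Semimetrics below the distance *)

Definition submetric rho := [/\ forall i j k, rho i k <= rho i j + rho j k,
  forall i j, rho i j = rho j i & forall i j, 0 <= rho i j <= D i j].

Lemma submetric_ge0 rho i j : submetric rho -> 0 <= rho i j.
Proof. by case=> _ _ /(_ i j)/andP[]. Qed.

Lemma submetric_le_len rho i j : submetric rho -> (i <= j)%N -> rho i j <= len i j.
Proof. by case=> _ _ /(_ i j)/andP[_ rho_le] ij; exact: le_trans (D_le_len ij). Qed.

Lemma submetric_exact rho u v i j : submetric rho -> geodesic u v -> D u v <= rho u v ->
  (u <= i)%N -> (i <= j)%N -> (j <= v)%N -> len i j <= rho i j.
Proof.
move=> rho_sub uv uv_exact ui ij jv; have [rho_triangle _ _] := rho_sub.
rewrite (geodesicE uv) (len_cat (leq_trans ui ij) jv) (len_cat ui ij) in uv_exact.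
have := submetric_le_len rho_sub ui; have := submetric_le_len rho_sub jv.
by have := rho_triangle u i v; have := rho_triangle i j v; lra.
Qed.

Lemma submetric_len_right rho a i j : submetric rho -> (a <= i)%N -> (a <= j)%N ->
  rho i j <= `|len a j - len a i|.
Proof.
move=> rho_sub ai aj; have [_ rho_sym _] := rho_sub.
have [ij|/ltnW ji] := leqP i j.
  by rewrite (len_cat ai ij) addrAC subrr add0r ger0_norm ?len_ge0 ?submetric_le_len.
rewrite rho_sym distrC (len_cat aj ji) addrAC subrr add0r.
by rewrite ger0_norm ?len_ge0 ?submetric_le_len.
Qed.

Lemma submetric_len_left rho a i j : submetric rho -> (i <= a)%N -> (j <= a)%N ->
  rho i j <= `|len j a - len i a|.
Proof.
move=> rho_sub ia ja; have [_ rho_sym _] := rho_sub.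
have [ij|/ltnW ji] := leqP i j.
  by rewrite (len_cat ij ja) distrC addrK ger0_norm ?len_ge0 ?submetric_le_len.
by rewrite rho_sym (len_cat ji ia) addrK ger0_norm ?len_ge0 ?submetric_le_len.
Qed.

(** ** Balanced arcs *)

Definition balance a i j := Num.min (len i a) (len a j).

Definition balanced_arc lo a hi p := [/\ (lo <= p.1 <= a)%N, (a <= p.2 <= hi)%N,
  geodesic p.1 p.2 & forall i j, (lo <= i <= a)%N -> (a <= j <= hi)%N -> geodesic i j ->
    balance a i j <= balance a p.1 p.2].

Lemma balanced_arc_exists lo a hi : (lo <= a)%N -> (a <= hi)%N ->
  exists p, balanced_arc lo a hi p.
Proof.
move=> lo_a a_hi; pose a0 : 'I_hi.+1 := Ordinal (a_hi : (a < hi.+1)%N).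
pose P := [pred p : 'I_hi.+1 * 'I_hi.+1 | [&& lo <= p.1, p.1 <= a, a <= p.2 & geodesic p.1 p.2]%N].
have Pa0 : P (a0, a0) by rewrite /= lo_a leqnn geodesicxx.
case: (arg_maxP (fun p : 'I_hi.+1 * 'I_hi.+1 => balance a p.1 p.2) Pa0).
move=> -[u v] /and4P[/= lo_u ua av uv] uv_max; exists (val u, val v).
split=> //=; rewrite ?lo_u ?av ?leq_ord // => i j /andP[lo_i ia] /andP[aj j_hi] ij.
have i_hi : (i < hi.+1)%N by rewrite ltnS (leq_trans ia).
by apply: (uv_max (Ordinal i_hi, Ordinal (j_hi : (j < hi.+1)%N))); rewrite /= lo_i ia aj.
Qed.

Section BalancedArcHalf.
Variables (lo a hi u v i j : nat) (rho rho' : nat -> nat -> R).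
Hypotheses (rho_sub : submetric rho) (rho'_sub : submetric rho').
Hypothesis uv_balanced : balanced_arc lo a hi (u, v).
Hypothesis uv_exact : D u v <= rho u v.
Hypothesis ij : geodesic i j.
Hypotheses (lo_ia : (lo <= i <= a)%N) (aj_hi : (a <= j <= hi)%N).

Lemma balanced_arc_half_left : len i a <= len a j -> len a j <= rho' a j ->
  D i j / 2 <= rho i j + rho' i j.
Proof.
have [rho_triangle _ _] := rho_sub; have [rho'_triangle rho'_sym _] := rho'_sub.
have [/= /andP[_ ua] /andP[av _] uv uv_max] := uv_balanced.
have [/andP[_ ia] /andP[aj _]] := (lo_ia, aj_hi) => iaj a_exact.
move: (uv_max i j lo_ia aj_hi ij); rewrite /balance (min_idPl iaj) le_min => /andP[ua_ge av_ge].
rewrite (geodesicE ij) (len_cat ia aj).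
apply: (@shorter_side_half _ _ rho rho' i a j v _ _ (len a v)) => //.
- exact: submetric_ge0.
- by rewrite rho'_sym submetric_le_len.
- rewrite -(len_cat ia av); apply: (submetric_exact rho_sub uv uv_exact) => //.
    rewrite leqNgt; apply/negP => iu; have := len_gt0 iu.
    by rewrite (len_cat (ltnW iu) ua) in ua_ge; lra.
  exact: leq_trans av.
- exact: submetric_len_right.
Qed.

Lemma balanced_arc_half_right : len a j <= len i a -> len i a <= rho' i a ->
  D i j / 2 <= rho i j + rho' i j.
Proof.
have [rho_triangle rho_sym _] := rho_sub; have [rho'_triangle rho'_sym _] := rho'_sub.
have [/= /andP[_ ua] /andP[av _] uv uv_max] := uv_balanced.
have [/andP[_ ia] /andP[aj _]] := (lo_ia, aj_hi) => aji a_exact.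
move: (uv_max i j lo_ia aj_hi ij); rewrite /balance (min_idPr aji) le_min => /andP[ua_ge av_ge].
rewrite (geodesicE ij) (len_cat ia aj) addrC rho_sym rho'_sym.
apply: (@shorter_side_half _ _ rho rho' j a i u _ _ (len u a)) => //.
- exact: submetric_ge0.
- exact: submetric_le_len.
- by rewrite rho'_sym.
- rewrite rho_sym addrC -(len_cat ua aj); apply: (submetric_exact rho_sub uv uv_exact) => //.
    exact: leq_trans aj.
  rewrite leqNgt; apply/negP => vj; have := len_gt0 vj.
  by rewrite (len_cat av (ltnW vj)) in av_ge; lra.
- exact: submetric_len_left.
Qed.

End BalancedArcHalf.

(** ** Greedy arcs *)

Definition greedy_next a := minn m (maxn a.+1 (farthest a)).
Definition greedy_pos k := iter k greedy_next 0%N.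

Lemma greedy_next_le a : (greedy_next a <= m)%N.
Proof. exact: geq_minl. Qed.

Lemma geodesic_le_greedy_next a j : geodesic a j -> (j <= m)%N -> (j <= greedy_next a)%N.
Proof. by move=> /farthest_max aj jm; rewrite leq_min jm leq_max aj orbT. Qed.

Lemma greedy_next_ge a : (a <= m)%N -> (a <= greedy_next a)%N.
Proof. exact: geodesic_le_greedy_next (geodesicxx a). Qed.

Lemma greedy_next_gt a : (a < m)%N -> (a < greedy_next a)%N.
Proof. by move=> am; rewrite leq_min am leq_max ltnSn. Qed.

Lemma greedy_next_geodesic a : (a <= m)%N ->
  geodesic a (greedy_next a) \/ (greedy_next a <= a.+1)%N.
Proof.
move=> am; have [le_aS|lt_Sa] := leqP (greedy_next a) a.+1; [by right|left].
apply: geodesic_sub (geodesic_farthest a) (leqnn a) (greedy_next_ge am) _.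
by move: lt_Sa; rewrite /greedy_next; lia.
Qed.

Lemma greedy_pos_le k : (greedy_pos k <= m)%N.
Proof. by case: k => //= k; exact: greedy_next_le. Qed.

Lemma greedy_pos_leS k : (greedy_pos k <= greedy_pos k.+1)%N.
Proof. exact: greedy_next_ge (greedy_pos_le k). Qed.

Lemma greedy_pos_ge k : (minn k m <= greedy_pos k)%N.
Proof.
elim: k => [|k IH]; first by rewrite min0n.
have := greedy_pos_leS k; have [k_lt|] := ltnP (greedy_pos k) m; last lia.
by have : (greedy_pos k < greedy_pos k.+1)%N := greedy_next_gt k_lt; lia.
Qed.

Lemma greedy_pos_locate i : (i < m)%N -> exists k, (greedy_pos k <= i < greedy_pos k.+1)%N.
Proof.
move=> im; have ex_pin : exists k, (greedy_pos k <= i)%N by exists 0%N.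
have greedy_pos_ub k : (greedy_pos k <= i)%N -> (k <= i)%N by have := greedy_pos_ge k; lia.
case: (ex_maxnP ex_pin greedy_pos_ub) => k ki k_max; exists k; rewrite ki ltnNge.
by apply/negP => /k_max; rewrite ltnn.
Qed.

Lemma greedy_exact rho k i j : submetric rho ->
    D (greedy_pos k) (greedy_pos k.+1) <= rho (greedy_pos k) (greedy_pos k.+1) ->
    geodesic i j -> (greedy_pos k <= i)%N -> (j <= greedy_pos k.+1)%N ->
  len i j <= rho i j.
Proof.
move=> rho_sub k_exact ij ki jk; have i_le_j := geodesic_le ij.
have [k_geo|k_edge] := greedy_next_geodesic (greedy_pos_le k).
  exact: submetric_exact rho_sub k_geo k_exact ki i_le_j jk.
have [<-|i_neq_j] := eqVneq i j; first by rewrite /len big_geq // submetric_ge0.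
rewrite -[greedy_next _]/(greedy_pos k.+1) in k_edge.
have [iE jE] : i = greedy_pos k /\ j = greedy_pos k.+1 by lia.
by rewrite -(geodesicE ij) iE jE.
Qed.

(** ** Six arc systems *)

Definition exact_on rho (A : nat -> nat * nat) :=
  forall k, D (A k).1 (A k).2 <= rho (A k).1 (A k).2.

Definition greedy_arcs k := (greedy_pos k, greedy_pos k.+1).

Definition single_arc p k := if k is 0%N then p else (p.2, p.2).

Lemma greedy_arc_system : arc_system m greedy_arcs.
Proof.
split=> k; first by rewrite greedy_pos_leS leqnn.
exact: leq_trans (greedy_pos_le k.+1) (leq_addl _ _).
Qed.

Lemma single_arc_system p : geodesic p.1 p.2 -> arc_system m (single_arc p).
Proof.
move=> p_geo; split=> [[|k]|[|k]] /=; rewrite ?leqnn ?andbT //; first exact: geodesic_le.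
  exact: geodesic_period.
exact: geodesic_period.
Qed.

Section AlternateArcs.
Variable best : nat -> nat * nat.
Hypothesis best_balanced : forall k,
  balanced_arc (greedy_pos k) (greedy_pos k.+1) (greedy_pos k.+2) (best k).

(* Every second balanced arc, since consecutive ones overlap. *)
Definition alternate_arcs (b : bool) k := best (b + k.*2)%N.

Lemma alternate_arc_system b : arc_system m (alternate_arcs b).
Proof.
split=> k; rewrite /alternate_arcs.
  have [_ /andP[_ kR] /geodesic_le k_le _] := best_balanced (b + k.*2)%N.
  have [/andP[kL _] _ _ _] := best_balanced (b + k.+1.*2)%N.
  by rewrite k_le; apply: leq_trans kR _; rewrite doubleS !addnS in kL *.
have [_ /andP[_ kR] _ _] := best_balanced (b + k.*2)%N.
by apply: leq_trans kR (leq_trans (greedy_pos_le _) (leq_addl _ _)).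
Qed.

Lemma unwrapped_half rho (rhoB : bool -> nat -> nat -> R) i j :
    submetric rho -> (forall b, submetric (rhoB b)) ->
    exact_on rho greedy_arcs -> (forall b, exact_on (rhoB b) (alternate_arcs b)) ->
    (i < m)%N -> (j <= m)%N -> geodesic i j ->
  exists b, D i j / 2 <= rho i j + rhoB b i j.
Proof.
move=> rho_sub rhoB_sub greedy alternate im jm ij.
have [k /andP[ki ik]] := greedy_pos_locate im; have i_le_j := geodesic_le ij.
have [jk|kj] := leqP j (greedy_pos k.+1).
  exists true; have := greedy_exact rho_sub (greedy k) ij ki jk.
  have := submetric_ge0 i j (rhoB_sub true).
  by rewrite (geodesicE ij); have := len_ge0 i j; lra.
have ik_geo : geodesic i (greedy_pos k.+1) := geodesic_sub ij (leqnn i) (ltnW ik) (ltnW kj).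
have kj_geo : geodesic (greedy_pos k.+1) j := geodesic_sub ij (ltnW ik) (ltnW kj) (leqnn j).
have jk2 : (j <= greedy_pos k.+2)%N := geodesic_le_greedy_next kj_geo jm.
have i_exact := greedy_exact rho_sub (greedy k) ik_geo ki (leqnn _).
have j_exact := greedy_exact rho_sub (greedy k.+1) kj_geo (leqnn _) jk2.
have lo_ia : (greedy_pos k <= i <= greedy_pos k.+1)%N by rewrite ki ltnW.
have aj_hi : (greedy_pos k.+1 <= j <= greedy_pos k.+2)%N by rewrite ltnW.
have := alternate (odd k) k./2; rewrite /alternate_arcs odd_double_half => best_exact.
have := best_balanced k; case: (best k) best_exact => u v /= uv_exact uv_balanced.
exists (odd k); rewrite addrC.
have [iaj|/ltW aji] := leP (len i (greedy_pos k.+1)) (len (greedy_pos k.+1) j).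
  exact: (balanced_arc_half_left (rhoB_sub _) rho_sub uv_balanced).
exact: (balanced_arc_half_right (rhoB_sub _) rho_sub uv_balanced).
Qed.

End AlternateArcs.

Lemma wrapped_half p u rho rhoL rhoR i j :
    submetric rho -> submetric rhoL -> submetric rhoR ->
    balanced_arc 0 m (m + m) p -> geodesic u m -> (forall i, geodesic i m -> (u <= i)%N) ->
    D p.1 p.2 <= rho p.1 p.2 -> D u m <= rhoL u m ->
    D m (farthest m) <= rhoR m (farthest m) ->
    (i < m)%N -> (m < j)%N -> geodesic i j ->
  D i j / 2 <= rho i j + rhoL i j \/ D i j / 2 <= rho i j + rhoR i j.
Proof.
move=> rho_sub rhoL_sub rhoR_sub p_balanced um u_min p_exact L_exact R_exact.
move=> /ltnW im /ltnW mj ij.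
have im_geo : geodesic i m := geodesic_sub ij (leqnn i) im mj.
have mj_geo : geodesic m j := geodesic_sub ij im mj (leqnn j).
have i_exact : len i m <= rhoL i m.
  by apply: submetric_exact rhoL_sub um L_exact _ im (leqnn m); exact: u_min.
have j_exact : len m j <= rhoR m j.
  apply: submetric_exact rhoR_sub (geodesic_farthest m) R_exact (leqnn m) mj _.
  exact: farthest_max.
have lo_im : (0 <= i <= m)%N by [].
have mj_hi : (m <= j <= m + m)%N by rewrite mj (leq_trans (geodesic_period ij)) ?leq_add2r.
case: p p_balanced p_exact => u' v' p_balanced p_exact.
have [imj|/ltW mji] := leP (len i m) (len m j); [right|left].
  exact: (balanced_arc_half_left rho_sub rhoR_sub p_balanced).
exact: (balanced_arc_half_right rho_sub rhoL_sub p_balanced).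
Qed.

Theorem six_arc_systems : exists A : nat -> nat -> nat * nat,
  (forall f, arc_system m (A f)) /\
  forall rho : nat -> nat -> nat -> R,
    (forall f, submetric (rho f)) -> (forall f, exact_on (rho f) (A f)) ->
    forall i j, (i < m)%N -> geodesic i j -> D i j / 2 <= \sum_(f < 6) rho f i j.
Proof.
have [best best_balanced] := choice (fun k =>
  balanced_arc_exists (greedy_pos_leS k) (greedy_pos_leS k.+1)).
have [p p_balanced] := balanced_arc_exists (leq0n m) (leq_addr m m).
have [u um u_min] := geodesic_leftmost m.
exists (nth greedy_arcs [:: greedy_arcs; alternate_arcs best true; alternate_arcs best false;
  single_arc (u, m); single_arc (m, farthest m); single_arc p]); split.
  case=> [|[|[|[|[|[|f]]]]]] /=; rewrite ?nth_nil; try exact: greedy_arc_system;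
    try exact: alternate_arc_system; apply: single_arc_system => //=.
    exact: geodesic_farthest.
  by case: p_balanced.
move=> rho rho_sub rho_exact i j im ij.
have rho_ge0 f : 0 <= rho f i j := submetric_ge0 i j (rho_sub f).
have pair_le_sum f g : (f < 6)%N -> (g < 6)%N -> g != f ->
    rho f i j + rho g i j <= \sum_(f < 6) rho f i j.
  move=> f6 g6 gf; rewrite (bigD1 (Ordinal f6)) // (bigD1 (Ordinal g6)) //= addrA lerDl.
  exact: sumr_ge0.
have [jm|mj] := leqP j m.
  have [|b|[] half] := unwrapped_half best_balanced (rho_sub 0%N)
      (rhoB := fun b => rho (if b then 1 else 2)%N) _ (rho_exact 0%N) _ im jm ij.
  - by move=> b.
  - by case: b; [exact: (rho_exact 1%N)|exact: (rho_exact 2)].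
  - exact: le_trans half (pair_le_sum 0%N 1%N _ _ _).
  - exact: le_trans half (pair_le_sum 0%N 2 _ _ _).
have [half|half] := wrapped_half (rho_sub 5) (rho_sub 3) (rho_sub 4) p_balanced um u_min
  (rho_exact 5 0%N) (rho_exact 3 0%N) (rho_exact 4 0%N) im mj ij.
- exact: le_trans half (pair_le_sum 5 3 _ _ _).
- exact: le_trans half (pair_le_sum 5 4 _ _ _).
Qed.

End Line.

(** * Geodesic arcs of face walks *)

Definition simple_walks (G : sgraph) (psi : dart G -> dart G) :=
  forall d d', fconnect psi d d' -> dart_src d = dart_src d' -> d = d'.

Lemma porbit_connect (T : finType) (s : {perm T}) x y : fconnect s x y -> y \in porbit s x.
Proof. by move=> /iter_findex <-; apply/porbitP; exists (findex s x y); rewrite permX. Qed.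

Section SimpleFaceWalks.
Variables (G : sgraph) (M : planar_embedding G).
Local Notation phi := (next_on_face (rot M)).

(* Exchanging the successors of two darts cuts a closed walk at a repeated vertex
   into two; the arrangement with the most orbits has no repetition left. *)
Lemma simple_face_walks : exists2 psi, face_walks M psi & simple_walks psi.
Proof.
pose P := [pred s : {perm dart G} |
  [forall d, (dart_src (s d) == dart_tgt d) && fconnect phi d (s d)]].
have Pphi : P (perm (@next_on_face_inj _ M)).
  by apply/forallP => d; rewrite permE next_on_face_src eqxx fconnect1.
case: (arg_maxnP (fun s : {perm dart G} => #|porbits s|) Pphi) => s /forallP Ps s_max.
have s_walks : face_walks M s.
  by split=> [|d|d]; [exact: perm_inj|case/andP: (Ps d) => /eqP|case/andP: (Ps d)].
exists s => // x y xy src_xy; apply/eqP; apply: contraT => x_neq_y.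
pose x' := (s^-1)%g x; pose y' := (s^-1)%g y.
have [sx sy] : s x' = x /\ s y' = y by rewrite !permKV.
have x'_neq_y' : x' != y' by rewrite (inj_eq perm_inj).
have y'x' : fconnect s y' x'.
  have s_sym := fconnect_sym (@perm_inj _ s).
  have := fconnect1 s x'; have := fconnect1 s y'; rewrite sx sy => y'y x'x.
  by rewrite s_sym; apply: connect_trans x'x (connect_trans xy _); rewrite s_sym.
have same_tgt : dart_tgt x' = dart_tgt y' by rewrite -!(face_walks_src s_walks) sx sy.
have phi_yx := face_walks_froot s_walks y'x'.
have /s_max : P (tperm x' y' * s)%g.
  apply/forallP => d; rewrite permM -froot_connect; last exact: next_on_face_inj.
  have s_phi e : froot phi e = froot phi (s e).
    by apply: (face_walks_froot s_walks); exact: fconnect1.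
  case: tpermP => [->|->|_ _]; rewrite (face_walks_src s_walks) -s_phi.
  - by rewrite same_tgt phi_yx !eqxx.
  - by rewrite same_tgt phi_yx !eqxx.
  - by rewrite !eqxx.
have := porbits_mul_tperm s x' y'.
by rewrite /= (porbit_connect y'x') x'_neq_y' /= addn0 addn1 => ->; rewrite ltnn.
Qed.

End SimpleFaceWalks.

Lemma iter_inj_order (T : finType) (f : T -> T) x i j : injective f ->
  (i < j + fingraph.order f x)%N -> (j < i + fingraph.order f x)%N ->
  iter i f x = iter j f x -> i = j.
Proof.
move=> f_inj; wlog ij : i j / (i <= j)%N => [wlog_ij i_lt j_lt xij|_].
  have [/wlog_ij -> //|/ltnW/wlog_ij ji] := leqP i j.
  by apply/esym/ji.
rewrite -{2}(subnKC ij) iterD => j_lt /(iter_inj f_inj) xE.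
have : findex f x (iter (j - i) f x) = (j - i)%N by apply: findex_iter; lia.
by rewrite -xE findex0; lia.
Qed.

Section GeodesicArcs.
Variables (R : realType) (G : sgraph) (M : planar_embedding G) (l : G -> G -> R).
Hypothesis l_sym : forall u v : G, adj u v -> l u v = l v u.
Hypothesis l_pos : forall u v : G, adj u v -> 0 < l u v.
Variable psi : dart G -> dart G.
Hypothesis psi_walks : face_walks M psi.
Local Notation dist := (graph_dist l).
Local Notation order := (fingraph.order psi).
Implicit Types (d o : dart G) (i j k : nat).
Let psi_inj : injective psi := face_walks_inj psi_walks.

Definition corner d i := dart_src (iter i psi d).
Definition arc d k := [seq corner d i | i <- iota 1 k].

Lemma corner_adj d i : adj (corner d i) (corner d i.+1).
Proof. by rewrite /corner /= (face_walks_src psi_walks); exact: valP (iter i psi d). Qed.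

Lemma corner_connected d i j : connect (@adj G) (corner d i) (corner d j).
Proof.
by apply: (face_walks_connected psi_walks); rewrite -froot_connect // !froot_iter.
Qed.

Lemma corner_period d i : corner d (i + order d) = corner d i.
Proof. by rewrite /corner iterD (iter_order psi_inj). Qed.

Lemma corner_shift d i j : corner (iter i psi d) j = corner d (i + j).
Proof. by rewrite /corner addnC iterD. Qed.

Lemma arc_shift d i k : arc (iter i psi d) k = [seq corner d j | j <- iota i.+1 k].
Proof.
rewrite -addn1 iotaDl -map_comp; apply: eq_map => j.
exact: corner_shift.
Qed.

Lemma walk_arc d k : walk (dart_src d) (corner d k) (arc d k).
Proof. by have := walk_iota (corner_adj d) (leq0n k); rewrite subn0. Qed.

Lemma corner_dist_le d i j : (i <= j)%N ->
  dist (corner d i) (corner d j) <= len (fun t => l (corner d t) (corner d t.+1)) i j.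
Proof.
move=> ij; rewrite /len -walk_length_iota; apply: graph_dist_le => //.
exact: walk_iota (corner_adj d) ij.
Qed.

Section ArcSystems.
Variable A : dart G -> nat -> nat * nat.
Hypothesis A_arcs : forall o, arc_system (order o) (A o).

Definition arc_ends :=
  [set d | `[< exists2 i, endpoint (A (froot psi d)) i & d = iter i psi (froot psi d) >]].

Lemma arc_endsP o i : froot psi o = o ->
  reflect (exists2 e, endpoint (A o) e & iter i psi o = iter e psi o) (iter i psi o \in arc_ends).
Proof. by move=> o_root; rewrite inE froot_iter // o_root; exact: asboolP. Qed.

Lemma endpoint_arc_ends o e : froot psi o = o -> endpoint (A o) e -> iter e psi o \in arc_ends.
Proof. by move=> o_root e_end; apply/arc_endsP => //; exists e. Qed.

Lemma arc_ends_hit d : exists n, iter n.+1 psi d \in arc_ends.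
Proof.
set o := froot psi d; have o_root : froot psi o = o by exact/root_root/fconnect_sym.
have e_end : endpoint (A o) (A o 0%N).1 by exists 0%N; left.
have : fconnect psi (psi d) (iter (A o 0%N).1 psi o).
  by rewrite -froot_connect // froot_succ // froot_iter // o_root.
move/iter_findex => dE; exists (findex psi (psi d) (iter (A o 0%N).1 psi o)).
by rewrite iterSr dE; exact: endpoint_arc_ends.
Qed.

Lemma return_map_arc o k : froot psi o = o -> ((A o k).1 < (A o k).2)%N ->
  return_map arc_ends_hit (iter (A o k).1 psi o) = iter (A o k).2 psi o.
Proof.
move=> o_root lt12.
have end1 : endpoint (A o) (A o k).1 by exists k; left.
have end2 : endpoint (A o) (A o k).2 by exists k; right.
have [n nE] : exists n, (A o k).2 = (n.+1 + (A o k).1)%N.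
  by exists ((A o k).2 - (A o k).1).-1; lia.
rewrite /return_map endpoint_arc_ends // nE iterD.
apply: first_hitE => [|i /andP[i_gt0 i_n]]; first by rewrite -iterD -nE endpoint_arc_ends.
rewrite -iterD; apply/arc_endsP => // -[e e_end ie].
have eE : (i + (A o k).1)%N = e.
  have := arc_system_window (A_arcs o) e_end; have := arc_system_window (A_arcs o) end1.
  have := arc_system_window (A_arcs o) end2.
  by move=> ? ? ?; apply: (iter_inj_order psi_inj _ _ ie); lia.
by have := arc_system_gap k (A_arcs o) e_end; lia.
Qed.

Lemma arc_system_packing : exists y, bond_packing l y /\ forall o k, froot psi o = o ->
  dist (corner o (A o k).1) (corner o (A o k).2) <=
  cut_metric y (corner o (A o k).1) (corner o (A o k).2).
Proof.
have [y y_pack y_exact] := chord_packing psi_walks arc_ends_hit l_sym l_pos.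
exists y; split=> // o k o_root; have [/(_ k)/andP[+ _] _] := A_arcs o.
rewrite leq_eqVlt => /predU1P[->|lt12]; first by rewrite graph_distxx // cut_metricxx.
by have := y_exact (iter (A o k).1 psi o); rewrite return_map_arc.
Qed.

End ArcSystems.

Lemma bond_packing_submetric y o : bond_packing l y ->
  submetric (fun i j => dist (corner o i) (corner o j))
    (fun i j => cut_metric y (corner o i) (corner o j)).
Proof.
move=> y_pack; have [y_ge0 _ _] := y_pack; split=> [i j k|i j|i j].
- exact: cut_metric_triangle.
- exact: cut_metric_sym.
by rewrite cut_metric_ge0 //= bond_packing_le_dist // corner_connected.
Qed.

Theorem geodesic_arc_packing : exists2 y, bond_packing l y & forall d k,
  shortest_path l (dart_src d) (corner d k) (arc d k) ->
  dist (dart_src d) (corner d k) / 12 <= cut_metric y (dart_src d) (corner d k).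
Proof.
pose D o i j := dist (corner o i) (corner o j).
pose L o t := l (corner o t) (corner o t.+1).
have D_triangle o i j k : D o i k <= D o i j + D o j k.
  by apply: graph_dist_triangle => //; exact: corner_connected.
have L_gt0 o t : 0 < L o t := l_pos (corner_adj o t).
have D_period o i : D o i (i + order o)%N = 0 by rewrite /D corner_period graph_distxx.
have [A A_arcs] := choice (fun o => six_arc_systems (fingraph.order_gt0 psi o) (L_gt0 o)
  (fun i => graph_distxx l_pos (corner o i)) (D_triangle o) (D_period o)
  (@corner_dist_le o)).
have [y y_spec] := choice (fun f => arc_system_packing (fun o => (A_arcs o).1 f)).
exists (fun S => \sum_(f < 6) 6%:R^-1 * y f S).
  by apply: (bond_packing_mean (y := fun f : 'I_6 => y f)) => f; case: (y_spec f).
move=> d k; set o := froot psi d; set i := findex psi o d.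
have o_root : froot psi o = o by exact/root_root/fconnect_sym.
have dE : iter i psi o = d by rewrite iter_findex // fconnect_sym // connect_root.
have -> : corner d k = corner o (i + k) by rewrite -corner_shift dE.
rewrite -dE -[dart_src _]/(corner o i) arc_shift => -[_ short].
have ik_geo : geodesic (D o) (L o) i (i + k).
  by rewrite /geodesic leq_addr /D -short -{1}(addKn i k) walk_length_iota eqxx.
have i_lt : (i < order o)%N.
  by apply: findex_max; rewrite fconnect_sym // connect_root.
have := (A_arcs o).2 (fun f u v => cut_metric (y f) (corner o u) (corner o v)) _ _ i _ i_lt ik_geo.
rewrite cut_metric_lincomb -mulr_sumr => half; rewrite mulrC ler_pdivlMl //.
apply: le_trans (half _ _) => [|f|f]; last 1 first.
- by move=> n; have [_ y_exact] := y_spec f; exact: y_exact.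
- by rewrite /D; lra.
by apply: bond_packing_submetric; case: (y_spec f).
Qed.

End GeodesicArcs.

(** * Geodesics on a face boundary *)

Section OrbitEdges.
Variables (G : sgraph) (psi : dart G -> dart G).
Implicit Types (d o : dart G) (e : G * G) (u v x z : G) (p : seq G).

Definition on_orbit o e :=
  [exists d, (froot psi d == o) && ((val d == e) || (val (dart_rev d) == e))].

Lemma on_orbitP o u v : reflect
  (exists2 d, froot psi d = o & (dart_src d, dart_tgt d) \in [:: (u, v); (v, u)])
  (on_orbit o (u, v)).
Proof.
apply: (iffP existsP) => [[d /andP[/eqP dO]]|[d dO]]; rewrite ?inE => de; exists d => //.
  rewrite !inE; case/orP: de => /eqP de; apply/orP.
    by left; rewrite -de -surjective_pairing.
  by right; case: de => <- <-.
rewrite dO eqxx; case/orP: de => /eqP[<- <-]; apply/orP; [left|right=> //].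
by rewrite -surjective_pairing.
Qed.

Lemma on_orbit_dart o d : on_orbit o (dart_src d, dart_tgt d) ->
  froot psi d = o \/ froot psi (dart_rev d) = o.
Proof.
case/on_orbitP => d' <-; rewrite !inE => /orP[] /eqP[src_d' tgt_d'].
  by left; rewrite (dart_eq src_d' tgt_d').
by right; rewrite (@dart_eq _ d' (dart_rev d)).
Qed.

Lemma walk_sep_orbit S o u v p : walk u v p -> all (on_orbit o) (walk_edges u p) ->
  sep S u v -> exists x z d, [/\ (x, z) \in walk_edges u p, d \in cut S, froot psi d = o &
    (dart_src d, dart_tgt d) \in [:: (x, z); (z, x)]].
Proof.
move=> uv /allP p_orbit /(walk_sep uv)[d dS dp]; exists (dart_src d), (dart_tgt d).
have [dO|dO] := on_orbit_dart (p_orbit _ dp); [exists d|exists (dart_rev d)].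
  by split=> //; rewrite mem_head.
by split; rewrite ?cut_rev // !inE eqxx orbT.
Qed.

End OrbitEdges.

Lemma edge_on_face_orbit (G : sgraph) (M : planar_embedding G) (f : dart G) (e : G * G) :
  edge_on_face M f e ->
  on_orbit (next_on_face (rot M)) (froot (next_on_face (rot M)) f) e.
Proof.
have in_face d : (d \in face_boundary M f) =
    (froot (next_on_face (rot M)) d == froot (next_on_face (rot M)) f).
  rewrite -fconnect_orbit -froot_connect 1?eq_sym //; exact: next_on_face_inj.
case: e => u v; rewrite /edge_on_face => /orP[] /mapP[d]; rewrite in_face => /eqP df de.
  by apply/on_orbitP; exists d; rewrite // /dart_src /dart_tgt -de mem_head.
by apply/on_orbitP; exists d; rewrite // /dart_src /dart_tgt -de !inE eqxx orbT.
Qed.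

Section OrbitPath.
Variables (G : sgraph) (M : planar_embedding G) (psi : dart G -> dart G).
Hypothesis psi_walks : face_walks M psi.
Hypothesis psi_simple : simple_walks psi.
Implicit Types (d o x : dart G) (u v z : G) (p q : seq G) (n : nat).
Let psi_inj : injective psi := face_walks_inj psi_walks.
Let psi_src := face_walks_src psi_walks.

Lemma on_orbit_ends o u v : on_orbit psi o (u, v) ->
  (exists2 d, froot psi d = o & dart_src d = u) /\
  (exists2 d, froot psi d = o & dart_src d = v).
Proof.
case/on_orbitP => d dO; rewrite !inE => /orP[] /eqP[<- <-].
  by split; [exists d|exists (psi d); rewrite ?froot_succ // psi_src].
by split; [exists (psi d); rewrite ?froot_succ // psi_src|exists d].
Qed.

Lemma on_orbit_last o u p : p != [::] -> all (on_orbit psi o) (walk_edges u p) ->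
  exists2 d, froot psi d = o & dart_src d = last u p.
Proof.
elim: p u => // z [|z' p] IH u _ /andP[uz p_orbit]; first by case/on_orbit_ends: uz.
exact: (IH z).
Qed.

Lemma on_orbit_neighbor x u : on_orbit psi (froot psi x) (u, dart_src x) ->
  u = dart_src (psi x) \/ exists2 x', psi x' = x & u = dart_src x'.
Proof.
case/on_orbitP => d /eqP; rewrite froot_connect // !inE => dx /orP[] /eqP[src_d tgt_d].
  right; exists d => //; apply: psi_simple; last by rewrite psi_src.
  by rewrite -froot_connect // froot_succ // froot_connect.
by left; rewrite psi_src -(psi_simple dx src_d).
Qed.

Lemma mkseq_corner_cons d n :
  mkseq (corner psi d) n.+1 = dart_src d :: mkseq (corner psi (psi d)) n.
Proof.
rewrite /mkseq /= -(addn0 1%N) iotaDl -map_comp; congr (_ :: _); apply: eq_map => i.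
by rewrite /corner /= -iterSr.
Qed.

Lemma orbit_path_arc o u p : uniq (u :: p) -> p != [::] ->
    all (on_orbit psi o) (walk_edges u p) ->
  exists2 d, froot psi d = o & u :: p = mkseq (corner psi d) (size p).+1 \/
    u :: p = rev (mkseq (corner psi d) (size p).+1).
Proof.
elim: p u => [|z p IH] u //= /andP[u_notin z_uniq] _ /andP[uz p_orbit].
case: p => [|z' p] in IH u_notin z_uniq p_orbit *.
  have /on_orbitP[d dO] := uz; rewrite !inE => /orP[] /eqP[<- <-]; exists d => //.
    by left; rewrite /mkseq /= /corner /= psi_src.
  by right; rewrite /mkseq /= /corner /= psi_src.
have u_z' : u <> z' by move=> uz'; rewrite uz' !inE eqxx orbT in u_notin.
have [d dO [zE|zE]] := IH z z_uniq isT p_orbit.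
  have [z_d z'_d] : z = dart_src d /\ z' = dart_src (psi d) by case: zE.
  have : on_orbit psi (froot psi d) (u, dart_src d) by rewrite dO -z_d.
  case/on_orbit_neighbor => [u_next|[d' d'E u_d']]; first by rewrite z'_d in u_z'.
  exists d'; first by rewrite -dO -d'E froot_succ.
  by left; rewrite zE u_d' [RHS]mkseq_corner_cons d'E.
move: (zE); rewrite [size _]/= 2!mkseqS !rev_rcons => -[z_d z'_d _].
pose x := iter (size p).+1 psi d.
have : on_orbit psi (froot psi x) (u, dart_src x).
  by move: uz; rewrite froot_iter // dO z_d.
case/on_orbit_neighbor => [u_next|[d' /psi_inj d'E u_d']].
  by exists d => //; right; rewrite [size _]/= mkseqS rev_rcons u_next -zE.
by case: u_z'; rewrite u_d' d'E z'_d.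
Qed.

End OrbitPath.

Lemma walk_maximal_prefix (G : sgraph) (P : pred (G * G)) (u : G) (p : seq G) :
  exists q r, [/\ p = q ++ r, all P (walk_edges u q) &
    if r is z :: _ then ~~ P (last u q, z) else true].
Proof.
elim: p u => [|z p IH] u; first by exists [::], [::].
have [Puz|nPuz] := boolP (P (u, z)); last by exists [::], (z :: p).
have [q [r [-> q_P r_nP]]] := IH z.
by exists (z :: q), r; rewrite walk_edges_cons /= Puz.
Qed.

Section FacePaths.
Variables (R : realType) (G : sgraph) (M : planar_embedding G) (l : G -> G -> R).
Hypothesis l_sym : forall u v : G, adj u v -> l u v = l v u.
Hypothesis l_pos : forall u v : G, adj u v -> 0 < l u v.
Variable psi : dart G -> dart G.
Hypothesis psi_walks : face_walks M psi.
Hypothesis psi_simple : simple_walks psi.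
Local Notation dist := (graph_dist l).
Local Notation phi := (next_on_face (rot M)).
Implicit Types (d f : dart G) (S : {set G}) (u v z : G) (p q r : seq G).
Let psi_inj : injective psi := face_walks_inj psi_walks.
Let psi_src := face_walks_src psi_walks.

(* A bond crosses the boundary of a face at most twice and every closed walk
   evenly, so inside a face it stays within one of the closed walks. *)
Lemma bond_one_orbit S d1 d2 : bond S -> d1 \in cut S -> d2 \in cut S ->
  froot phi d1 = froot phi d2 -> froot psi d1 = froot psi d2.
Proof.
move=> S_bond d1S d2S phi12; have [d' d'_d1 faceE] := bond_face M S_bond d1S.
have [d3 [d3S d3_d1 psi31]] : exists d3, [/\ d3 \in cut S, d3 != d1 & froot psi d3 = froot psi d1].
  have [d3 /and3P[d3S d3_d1 /eqP psi31]|no_d3] :=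
    pickP [pred d | [&& d \in cut S, d != d1 & froot psi d == froot psi d1]]; first by exists d3.
  have := cut_orbit_even S (froot psi d1) psi_inj psi_src; rewrite (bigD1 d1) //= eqxx.
  by rewrite big1 // => d /andP[dS d_d1]; have := no_d3 d; rewrite /= dS d_d1.
have : d3 \in [set d in cut S | froot phi d == froot phi d1].
  rewrite inE d3S; apply/eqP/(face_walks_froot psi_walks).
  by rewrite -froot_connect // psi31.
rewrite faceE !inE (negPf d3_d1) => /eqP d3E.
have : d2 \in [set d in cut S | froot phi d == froot phi d1] by rewrite inE d2S phi12 eqxx.
by rewrite faceE !inE -d3E => /orP[] /eqP ->.
Qed.

Lemma orbit_sep_cut S d d' : fconnect psi d d' -> sep S (dart_src d) (dart_src d') ->
  exists2 d1, d1 \in cut S & froot psi d1 = froot psi d.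
Proof.
move=> /iter_findex <-; elim: (findex _ _ _) => [|n IH] /=; first by rewrite sepxx.
rewrite psi_src (sep_addb (dart_src (iter n psi d))).
have [/IH //|_ /= d_n] := boolP (sep S (dart_src d) _).
by exists (iter n psi d); rewrite ?in_cut // froot_iter.
Qed.

Lemma off_orbit_not_sep S f d u v p : bond S -> d \in cut S -> froot phi d = froot phi f ->
    walk u v p -> all (edge_on_face M f) (walk_edges u p) ->
    all (predC (on_orbit psi (froot psi d))) (walk_edges u p) ->
  sep S u v = false.
Proof.
move=> S_bond dS df uv p_face /allP p_off; apply/negbTE/negP => S_uv.
have p_phi : all (on_orbit phi (froot phi f)) (walk_edges u p).
  by apply: sub_all p_face => e; exact: edge_on_face_orbit.
have [x [z [d' [xz d'S d'f d'E]]]] := walk_sep_orbit uv p_phi S_uv.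
have /negP[] := p_off _ xz; apply/on_orbitP; exists d' => //.
by apply: (bond_one_orbit S_bond) => //; rewrite d'f.
Qed.

Lemma off_orbit_walk_closed f d u v p : froot phi d = froot phi f ->
    (exists2 x, froot psi x = froot psi d & dart_src x = u) ->
    (exists2 x, froot psi x = froot psi d & dart_src x = v) ->
    walk u v p -> all (edge_on_face M f) (walk_edges u p) ->
    all (predC (on_orbit psi (froot psi d))) (walk_edges u p) ->
  u = v.
Proof.
move=> df [x xd <-] [z zd <-] xz_p p_face p_off; apply/eqP; apply: contraT => x_z.
have xz : fconnect psi x z by rewrite -froot_connect // xd zd.
have [S S_bond S_xz] := bond_separating (face_walks_connected psi_walks xz) x_z.
have [d1 d1S d1x] := orbit_sep_cut xz S_xz; rewrite -xd -d1x in p_off.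
suff d1f : froot phi d1 = froot phi f.
  by rewrite (off_orbit_not_sep S_bond d1S d1f xz_p) in S_xz.
rewrite -df; apply: (face_walks_froot psi_walks).
by rewrite -froot_connect // d1x xd.
Qed.

Lemma face_path_first_run f u p : uniq (u :: p) -> path (@adj G) u p -> p != [::] ->
    all (edge_on_face M f) (walk_edges u p) ->
  exists d q r, [/\ froot phi d = froot phi f, p = q ++ r /\ q != [::],
    all (on_orbit psi (froot psi d)) (walk_edges u q) &
    all (predC (on_orbit psi (froot psi d))) (walk_edges (last u q) r)].
Proof.
case: p => // z p u_uniq up _ p_face; have /andP[uz_face _] := p_face.
have /on_orbitP[d df d_uz] := edge_on_face_orbit uz_face.
pose on := on_orbit psi (froot psi d); have uz : on (u, z) by apply/on_orbitP; exists d.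
have [q [r [pE q_on r_off]]] := walk_maximal_prefix on z p.
have zq_on : all on (walk_edges u (z :: q)) by rewrite walk_edges_cons /= uz.
have [q' [r' [rE q'_off r'_on]]] := walk_maximal_prefix (predC on) (last z q) r.
exists d, (z :: q), r; split; rewrite ?pE //.
suff -> : r = q' by [].
case: r' rE r'_on => [|t r'] rE; first by rewrite rE cats0.
rewrite /= negbK => r'_on; rewrite rE in pE.
have same_end : last z q = last (last z q) q'.
  apply: (off_orbit_walk_closed (p := q') df) => //.
  - exact: (on_orbit_last psi_walks (p := z :: q)) zq_on.
  - by case: (on_orbit_ends psi_walks r'_on).
  - by move: up; rewrite pE -cat_cons !cat_path => /and3P[_ q'_path _]; exact: walk_last.
  - by move: p_face; rewrite pE -cat_cons !walk_edges_cat !all_cat => /and3P[].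
have : uniq ((z :: q) ++ q' ++ t :: r') by move: u_uniq; rewrite pE cons_uniq => /andP[].
rewrite cat_uniq => /and3P[_ /hasPn no_repeat _].
case: q' => [|z' q'] in rE q'_off r'_on same_end no_repeat pE *.
  by rewrite rE /= r'_on in r_off.
have last_in : last z q \in (z' :: q') ++ t :: r' by rewrite same_end mem_cat /= mem_last.
by have := no_repeat _ last_in; rewrite /= mem_last.
Qed.

Variables (y : {set G} -> R) (c : R).
Hypothesis y_pack : bond_packing l y.
Hypothesis y_arc : forall d k, shortest_path l (dart_src d) (corner psi d k) (arc psi d k) ->
  dist (dart_src d) (corner psi d k) / c <= cut_metric y (dart_src d) (corner psi d k).

Lemma orbit_path_bound o u v p : p != [::] -> shortest_path l u v p ->
  all (on_orbit psi o) (walk_edges u p) -> dist u v / c <= cut_metric y u v.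
Proof.
move=> p_neq0 uv_p p_orbit; have u_uniq := shortest_path_uniq l_pos uv_p.
have [d _ [up|up]] := orbit_path_arc psi_walks psi_simple u_uniq p_neq0 p_orbit.
  have [/andP[_ /eqP v_last] _] := uv_p; case: up uv_p v_last => -> pE uv_p v_last.
  have vE : v = corner psi d (size p).
    by have /andP[_ /eqP <-] := walk_arc psi_walks d (size p); rewrite -v_last {1}pE.
  by rewrite vE; apply: y_arc; rewrite -vE -[arc _ _ _]pE.
have d_walk := walk_arc psi_walks d (size p).
have [uE pE] : u = corner psi d (size p) /\ p = rev (belast (dart_src d) (arc psi d (size p))).
  move: up; rewrite -[mkseq _ _]/(dart_src d :: arc psi d (size p)).
  rewrite [dart_src d :: _]lastI rev_rcons => -[-> pE].
  by split=> //; case/andP: d_walk => _ /eqP.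
have [/andP[_ /eqP v_last] p_len] := uv_p.
have vE : v = dart_src d.
  have /andP[_ /eqP <-] := walk_rev d_walk.
  by rewrite -v_last -uE -pE.
rewrite vE uE graph_dist_sym // cut_metric_sym; apply: y_arc; split=> //.
by rewrite -(walk_length_rev l_sym d_walk) -pE -uE p_len vE graph_dist_sym.
Qed.

Lemma cut_metric_first_run f d u v q r : froot phi d = froot phi f ->
    walk u v (q ++ r) ->
    all (on_orbit psi (froot psi d)) (walk_edges u q) ->
    all (edge_on_face M f) (walk_edges (last u q) r) ->
    all (predC (on_orbit psi (froot psi d))) (walk_edges (last u q) r) ->
  cut_metric y u (last u q) + cut_metric y (last u q) v <= cut_metric y u v.
Proof.
move=> df; rewrite walk_cat => /andP[uq qv] q_on r_face r_off.
have [y_ge0 y_bond _] := y_pack; rewrite /cut_metric -big_split; apply: ler_sum => S _ /=.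
have [S_bond|/y_bond ->] := boolP (bond S); last by rewrite !mul0r addr0.
rewrite -mulrDr ler_wpM2l // (sep_addb (last u q) S u v).
have [S_uq|_] := boolP (sep S u (last u q)); last by rewrite add0r.
have [x [z [d' [_ d'S d'd _]]]] := walk_sep_orbit uq q_on S_uq.
rewrite (off_orbit_not_sep S_bond d'S _ qv r_face) ?addr0 ?d'd //.
rewrite -df; apply: (face_walks_froot psi_walks).
by rewrite -froot_connect // d'd.
Qed.

Lemma face_path_bound f u v p : shortest_path l u v p ->
  all (edge_on_face M f) (walk_edges u p) -> dist u v / c <= cut_metric y u v.
Proof.
have [n] := ubnP (size p); elim: n u p => // n IH u p p_size uv_p p_face.
have [uv _] := uv_p; have [p0|p_neq0] := eqVneq p [::].
  by move: uv; rewrite p0 /walk /= => /eqP ->; rewrite graph_distxx // mul0r cut_metricxx.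
have [up _] := andP uv.
have [d [q [r [df [pE q_neq0] q_on r_off]]]] :=
  face_path_first_run (shortest_path_uniq l_pos uv_p) up p_neq0 p_face.
rewrite {}pE in p_size uv_p p_face uv *.
have [uq qv ->] := shortest_path_cat l_pos uv_p.
move: p_face; rewrite walk_edges_cat all_cat => /andP[_ r_face].
apply: le_trans (cut_metric_first_run df uv q_on r_face r_off).
rewrite mulrDl; apply: lerD; first exact: orbit_path_bound q_neq0 uq q_on.
apply: IH qv r_face.
rewrite size_cat ltnS in p_size; apply: leq_trans p_size.
by rewrite -[ltnLHS]add0n ltn_add2r lt0n size_eq0.
Qed.

End FacePaths.

Lemma cut_metric_l1_embedding (R : realType) (V : finType) (y : {set V} -> R) :
  (forall S, 0 <= y S) ->
  exists (k : nat) (g : V -> 'rV[R]_k), forall u v, l1_norm (g u - g v) = cut_metric y u v.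
Proof.
move=> y_ge0; exists #|{set V}|, (fun u => \row_i (y (enum_val i) * (u \in enum_val i)%:R)).
move=> u v; rewrite /l1_norm /cut_metric [RHS](reindex _ (onW_bij _ (@enum_val_bij {set V}))).
apply: eq_bigr => i _; rewrite !mxE -mulrBr normrM ger0_norm //; congr (_ * _).
by rewrite /sep; do 2 case: (_ \in _); rewrite ?subrr ?subr0 ?sub0r ?normrN ?normr0 ?normr1.
Qed.

Theorem theorem9 (R : realType) (G : sgraph) (M : planar_embedding G)
  (l : G -> G -> R)
  (l_sym : forall u v : G, adj u v -> l u v = l v u)
  (l_pos : forall u v : G, adj u v -> 0 < l u v) :
  exists (k : nat) (g : G -> 'rV[R]_k),
    (forall u v : G, adj u v -> l1_norm (g u - g v) <= graph_dist l u v) /\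
    (forall u v : G, geodesic_pair l M u v ->
       graph_dist l u v / 21%:R <= l1_norm (g u - g v)).
Proof.
have [psi psi_walks psi_simple] := simple_face_walks M.
have [y y_pack y_arc] := geodesic_arc_packing l_sym l_pos psi_walks.
have [y_ge0 _ y_adj] := y_pack.
have [k [g gE]] := cut_metric_l1_embedding y_ge0.
exists k, g; split=> [u v|u v [f [_ _ [p uv_p p_face]]]]; rewrite gE; first exact: y_adj.
apply: le_trans (face_path_bound l_sym l_pos psi_walks psi_simple y_pack y_arc uv_p p_face).
by rewrite ler_wpM2l ?graph_dist_ge0 // lef_pV2 ?posrE ?ltr0n // ler_nat.
Qed.
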